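(* Let $m>0$ and $k\ge 2$ be integers. For each $i$, let $d_i$ be the (complex) dimension of the locus of Gorenstein schemes in the punctual Hilbert scheme of length $i$ subschemes of $\mathbb{C}^m$ supported at a fixed point. Set $N=\max\{d_i+i \mid 2\le i\le k\}$. Then there exist (linearly) $k$-regular continuous maps $\mathbb{R}^m\to\mathbb{R}^N$ and $\mathbb{C}^m\to\mathbb{C}^N$.
   Context: For $\mathbb{F}\in\{\mathbb{R},\mathbb{C}\}$, a continuous map $f\colon \mathbb{F}^m\to\mathbb{F}^N$ is (linearly) $k$-regular if the images of any $k$ pairwise distinct points are linearly independent. A finite subscheme of $\mathbb{C}^m$ has length equal to the $\mathbb{C}$-dimension of its coordinate ring. The punctual Hilbert scheme of length $i$ subschemes of $\mathbb{C}^m$ at a point $p$ parametrises finite subschemes of length $i$ supported set-theoretically only at $p$ (up to isomorphism independent of $p$). A finite scheme $R$ of length $i$ is Gorenstein if it contains only finitely many subschemes of length $i-1$ (equivalently, its coordinate ring is a Gorenstein Artin algebra, i.e. each local factor has one-dimensional socle); the Gorenstein locus is the (Zariski-open) subset of Gorenstein schemes. *)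

(* Defs.v *)
From HB Require Import structures.
From mathcomp Require Import all_boot all_order all_algebra.
From mathcomp Require Import complex.
From mathcomp Require Import Rstruct.

Set Implicit Arguments.
Unset Strict Implicit.
Unset Printing Implicit Defensive.

Import Order.TTheory GRing.Theory Num.Theory.
Local Open Scope ring_scope.

Notation RR := Rdefinitions.R.
Notation CC := (Rdefinitions.R)[i].

Definition rv_continuous (F : numFieldType) (m N : nat)
    (f : 'rV[F]_m -> 'rV[F]_N) : Prop :=
  forall (x : 'rV[F]_m) (eps : F), 0 < eps ->
  exists2 delta : F, 0 < delta &
    forall y : 'rV[F]_m, (forall j, `|y 0 j - x 0 j| < delta) ->
      forall l, `|f y 0 l - f x 0 l| < eps.

Definition kregular (F : numFieldType) (m N k : nat)
    (f : 'rV[F]_m -> 'rV[F]_N) : Prop :=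
  rv_continuous f /\
  forall x : 'I_k -> 'rV[F]_m, injective x ->
    row_free (\matrix_(j < k) f (x j)).

Section Zariski.
Variables (F : fieldType) (T : Type).

Inductive polyfun : ((T -> F) -> F) -> Prop :=
  | pf_cst (c : F) : polyfun (fun _ => c)
  | pf_coord (t : T) : polyfun (fun x => x t)
  | pf_add p q : polyfun p -> polyfun q -> polyfun (fun x => p x + q x)
  | pf_mul p q : polyfun p -> polyfun q -> polyfun (fun x => p x * q x).

Definition zclosed (Z : (T -> F) -> Prop) : Prop :=
  exists S : ((T -> F) -> F) -> Prop,
    (forall p, S p -> polyfun p) /\
    (forall x, Z x <-> forall p, S p -> p x = 0).

Definition zirreducible (Z : (T -> F) -> Prop) : Prop :=
  [/\ zclosed Z, exists x, Z x &
    forall Z1 Z2, zclosed Z1 -> zclosed Z2 ->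
      (forall x, Z x <-> Z1 x \/ Z2 x) ->
      (forall x, Z1 x <-> Z x) \/ (forall x, Z2 x <-> Z x)].

Definition zclosure (X : (T -> F) -> Prop) : (T -> F) -> Prop :=
  fun x => forall p, polyfun p -> (forall y, X y -> p y = 0) -> p x = 0.

Definition zchain (X : (T -> F) -> Prop) (d : nat) : Prop :=
  exists Z : nat -> (T -> F) -> Prop,
    [/\ forall j, (j <= d)%N -> zirreducible (Z j),
        forall j, (j < d)%N ->
          (forall x, Z j x -> Z j.+1 x) /\ (exists x, Z j.+1 x /\ ~ Z j x)
      & forall x, Z d x -> zclosure X x].

Definition zdim (X : (T -> F) -> Prop) (d : nat) : Prop :=
  zchain X d /\ forall e, zchain X e -> (e <= d)%N.

End Zariski.

(* A length-i subscheme supported at 0 is an ideal I of F[x_1..x_m] with     *)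
(* m^i <= I and dim F[x]/I = i; it is the same as an ideal of codimension i  *)
(* in the truncated algebra V = F[x]/m^i, whose basis consists of the        *)
(* monomials of total degree < i.                                            *)

Definition mon (m i : nat) :=
  {e : {ffun 'I_m -> 'I_i} | (\sum_(j < m) (e j : nat) < i)%N}.

Section Truncated.
Variables (F : fieldType) (m i : nat).

Definition tpoly := mon m i -> F.

(* multiplication in V (products of degree >= i are dropped) *)
Definition tmul (f g : tpoly) : tpoly := fun e =>
  \sum_(a : mon m i) \sum_(b : mon m i)
    (if [forall j, ((val a j : nat) + val b j == val e j)%N]
     then f a * g b else 0).

Definition tideal (W : tpoly -> Prop) : Prop :=
  [/\ W (fun _ => 0),
      forall v w, W v -> W w -> W (fun e => v e + w e)
    & forall g v, W v -> W (tmul g v)].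

(* J is (the ideal of) a subscheme of length one less than the subscheme of
   the ideal W, i.e. an ideal J containing W with dim J = dim W + 1 *)
Definition colength_one_less (W J : tpoly -> Prop) : Prop :=
  tideal J /\
  exists v : tpoly, ~ W v /\
    (forall u, J u <-> exists w a, W w /\ u = (fun e => w e + a * v e)).

Definition gorenstein (W : tpoly -> Prop) : Prop :=
  exists l : list (tpoly -> Prop),
    forall J, colength_one_less W J -> List.In J l.

(* number of monomials, and codimension-i subspaces have dimension c *)
Definition nmon := #|{: mon m i}|.
Definition cdim := (nmon - i)%N.

Definition rowspan (x : 'I_cdim * mon m i -> F) : tpoly -> Prop :=
  fun v => exists a : 'I_cdim -> F,
    v = (fun e => \sum_(r < cdim) a r * x (r, e)).

(* Affine chart coordinates on the Grassmannian of c-dimensional subspaces of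
   V: matrices containing an identity c x c submatrix (on columns J). The set
   below is the union over all standard charts of the Gorenstein locus of the
   punctual Hilbert scheme, viewed inside the Grassmannian of
   (dim V - i)-dimensional subspaces of V, each chart being the affine space
   of matrices with identity block on the columns J. *)
Definition gor_locus_charts : ('I_cdim * mon m i -> F) -> Prop :=
  fun x =>
    [/\ exists J : 'I_cdim -> mon m i, injective J /\
          (forall r r', x (r, J r') = if r == r' then 1 else 0),
        tideal (rowspan x)
      & gorenstein (rowspan x)].

End Truncated.

(* Main.v *)
Require Import Defs.
From HB Require Import structures.
From mathcomp Require Import all_boot all_order all_algebra.
From mathcomp Require Import complex.
From mathcomp Require Import Rstruct ring.
From Stdlib Require Import Classical ClassicalEpsilon FunctionalExtensionality.
From Stdlib Require Import PropExtensionality.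
From Stdlib Require Rtopology.
From mathcomp Require Import perm mpoly closed_field.

(* A functional phi on the polynomials that kills the monomials of degree at
   least k defines the ideal Ann(phi) of all f with phi(f g) = 0 for all g; it
   is Gorenstein, and its colength is the rank of the Hankel matrix
   (phi(x^(a+b))).  So the functionals of Hankel rank r >= 2 lie in the spans
   of the Gorenstein schemes of length r at 0, which form a family of
   dimension d_r + r, and N generic (in particular, some integral) linear
   forms L_1, ..., L_N on the space of functionals have no common zero among
   the nonzero functionals of Hankel rank at most k.
   The L_l are read as polynomials f_l of degree less than k.  If they were
   linearly dependent on k distinct points arbitrarily close to 0, then the
   combinations of evaluations at these points that kill all f_l, suitably
   normalised, would accumulate at a nonzero functional of Hankel rank at most
   k that kills the monomials of degree at least k and all L_l.  Hence
   (f_1, ..., f_N) is k-regular on a small polydisc around 0, into which R^m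
   and C^m embed.
   The genericity statement is a count: a set in which any e + 1 coordinates
   are algebraically dependent carries only O(D^e) polynomial functions of
   degree D, so that any e + 1 polynomial functions on it are algebraically
   dependent; and e independent coordinates on a set yield a chain of length e
   of irreducible closed subsets of its closure, by slicing. *)

Set Implicit Arguments.
Unset Strict Implicit.
Unset Printing Implicit Defensive.
Import Order.TTheory GRing.Theory Num.Theory.
Local Open Scope ring_scope.


(** * Polynomial functions *)

Section PolyFun.
Variables (F : fieldType) (T : Type).
Implicit Types p q : (T -> F) -> F.

Lemma polyfun_ext p q : polyfun p -> p =1 q -> polyfun q.
Proof. by move=> pp /functional_extensionality <-. Qed.

Lemma polyfun_opp p : polyfun p -> polyfun (fun x => - p x).
Proof.
move=> pp; apply: polyfun_ext (pf_mul (pf_cst T (-1)) pp) _ => x.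
by rewrite mulN1r.
Qed.

Lemma polyfun_sum (I : Type) (r : seq I) (P : pred I) (f : I -> (T -> F) -> F) :
  (forall i, P i -> polyfun (f i)) ->
  polyfun (fun x => \sum_(i <- r | P i) f i x).
Proof.
move=> pf; elim: r => [|i r IH].
  by apply: polyfun_ext (pf_cst T 0) _ => x; rewrite big_nil.
case Pi: (P i); last first.
  by apply: polyfun_ext IH _ => x; rewrite big_cons Pi.
by apply: polyfun_ext (pf_add (pf i Pi) IH) _ => x; rewrite big_cons Pi.
Qed.

Lemma polyfun_prod (I : Type) (r : seq I) (P : pred I) (f : I -> (T -> F) -> F) :
  (forall i, P i -> polyfun (f i)) ->
  polyfun (fun x => \prod_(i <- r | P i) f i x).
Proof.
move=> pf; elim: r => [|i r IH].
  by apply: polyfun_ext (pf_cst T 1) _ => x; rewrite big_nil.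
case Pi: (P i); last first.
  by apply: polyfun_ext IH _ => x; rewrite big_cons Pi.
by apply: polyfun_ext (pf_mul (pf i Pi) IH) _ => x; rewrite big_cons Pi.
Qed.

Lemma polyfun_exp p n : polyfun p -> polyfun (fun x => p x ^+ n).
Proof.
move=> pp; elim: n => [|n IH]; first exact: pf_cst.
by apply: polyfun_ext (pf_mul pp IH) _ => x; rewrite exprS.
Qed.

Lemma polyfun_comp (I : Type) (P : (I -> F) -> F) (f : I -> (T -> F) -> F) :
  polyfun P -> (forall i, polyfun (f i)) ->
  polyfun (fun x => P (fun i => f i x)).
Proof.
move=> pP pf; elim: pP => [c|i|P1 P2 _ IH1 _ IH2|P1 P2 _ IH1 _ IH2].
- exact: pf_cst.
- exact: pf.
- exact: pf_add.
- exact: pf_mul.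
Qed.

Lemma polyfun_det n (M : 'I_n -> 'I_n -> (T -> F) -> F) :
  (forall i j, polyfun (M i j)) ->
  polyfun (fun x => \det (\matrix_(i, j) M i j x)).
Proof.
move=> pM; rewrite /determinant; apply: polyfun_sum => s _.
apply: pf_mul; first exact: pf_cst.
have H : polyfun (fun x => \prod_i M i (s i) x) by apply: polyfun_prod.
by apply: polyfun_ext H _ => x; apply: eq_bigr => i _; rewrite mxE.
Qed.

Lemma polyfun_curve p (c : T -> {poly F}) :
  polyfun p -> exists q : {poly F}, forall t, p (fun i => (c i).[t]) = q.[t].
Proof.
elim=> [a|i|p1 p2 _ [q1 h1] _ [q2 h2]|p1 p2 _ [q1 h1] _ [q2 h2]].
- by exists a%:P => t; rewrite hornerC.
- by exists (c i).
- by exists (q1 + q2) => t; rewrite hornerD h1 h2.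
- by exists (q1 * q2) => t; rewrite hornerM h1 h2.
Qed.

End PolyFun.

(** Nontriviality of the relation is expressed by a point where [P] does not vanish; over an
    infinite field this says that [P] is a nonzero polynomial. *)
Definition algdep (F : fieldType) (T I : Type) (X : (T -> F) -> Prop)
    (f : I -> (T -> F) -> F) : Prop :=
  exists2 P : (I -> F) -> F, polyfun P /\ (exists v, P v <> 0) &
    forall x, X x -> P (fun i => f i x) = 0.

(** * Nonvanishing of polynomial functions over an infinite field *)

Section NonZero.
Variable F : numFieldType.

Lemma poly_nonroot (q : {poly F}) : q != 0 -> exists n : nat, q.[n%:R] != 0.
Proof.
move=> q0; apply/not_all_not_ex => H.
have /(max_poly_roots q0) : all (root q) [seq (n%:R : F) | n <- iota 0 (size q)].
  by apply/allP => x /mapP[n _ ->]; rewrite /root; apply/negPn/negP/H.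
rewrite size_map size_iota ltnn => U. apply: notF; apply: U.
by rewrite map_inj_uniq ?iota_uniq //; apply: mulrIn; rewrite oner_neq0.
Qed.

(** On the line through [v] and [w] both functions become nonzero polynomials in one variable, and
    their product has a non-root. This expresses the irreducibility of affine space. *)
Lemma polyfun_mul_neq0 (T : Type) (p q : (T -> F) -> F) :
  polyfun p -> polyfun q -> (exists v, p v <> 0) -> (exists v, q v <> 0) ->
  exists v, p v <> 0 /\ q v <> 0.
Proof.
move=> pp pq [v pv] [w qw].
pose c i : {poly F} := (v i)%:P + (w i - v i)%:P * 'X.
have c0 : (fun i => (c i).[0]) = v.
  by apply: functional_extensionality => i; rewrite !hornerE.
have c1 : (fun i => (c i).[1]) = w.
  by apply: functional_extensionality => i; rewrite /c hornerD hornerM !hornerC hornerX mulr1 subrKC.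
have [P hP] := polyfun_curve c pp; have [Q hQ] := polyfun_curve c pq.
have P0 : P != 0.
  by apply/eqP => P0; apply: pv; rewrite -c0 hP P0 horner0.
have Q0 : Q != 0.
  by apply/eqP => Q0; apply: qw; rewrite -c1 hQ Q0 horner0.
have [n] := poly_nonroot (mulf_neq0 P0 Q0).
rewrite hornerM mulf_eq0 => /norP[/eqP Pn /eqP Qn].
by exists (fun i => (c i).[n%:R]); rewrite hP hQ.
Qed.

(** The coordinates are made natural numbers one at a time. Natural coefficients are what lets the
    same linear forms serve over [RR] and over [CC]. *)
Lemma polyfun_natpoint (T : finType) (p : (T -> F) -> F) :
  polyfun p -> (exists v, p v <> 0) -> exists a : T -> nat, p (fun t => (a t)%:R) <> 0.
Proof.
move=> pp [v0 pv0].
suff H (s : seq T) : exists v, p v <> 0 /\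
    forall t, t \in s -> exists n : nat, v t = n%:R.
  have [v [pv /= hv]] := H (enum T).
  have {}hv t := hv t (mem_enum T t).
  exists (fun t => sval (constructive_indefinite_description _ (hv t))).
  suff -> : (fun t => (sval (constructive_indefinite_description _ (hv t)))%:R) = v
    by [].
  apply: functional_extensionality => t.
  by case: (constructive_indefinite_description _ (hv t)).
elim: s => [|t s [v [pv hv]]]; first by exists v0.
pose c i : {poly F} := if i == t then 'X else (v i)%:P.
have [P hP] := polyfun_curve c pp.
have P0 : P != 0.
  apply/eqP => P0; apply: pv; have := hP (v t); rewrite P0 horner0 => <-.
  congr p; apply: functional_extensionality => i; rewrite /c.
  by case: eqP => [->|_]; rewrite !hornerE.
have [n Pn] := poly_nonroot P0.
exists (fun i => (c i).[n%:R]); split; first by rewrite hP; apply/eqP.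
move=> i; rewrite inE /c; case: eqP => [_ _|_ /= /hv[k ->]].
  by exists n; rewrite hornerX.
by exists k; rewrite hornerC.
Qed.

(* Kronecker substitution [y_j = t ^ (D ^ j)] separates the monomials whose
   exponents are less than [D]. *)
Lemma polyfun_sum_monomials_neq0 (q D : nat) (l : {ffun 'I_q -> 'I_D} -> F) :
  (exists u, l u != 0) ->
  exists v : 'I_q -> F, \sum_u l u * \prod_j v j ^+ u j <> 0.
Proof.
move=> [u0 lu0].
pose code (u : {ffun 'I_q -> 'I_D}) := (\sum_(j < q) u j * D ^ j)%N.
have code_inj : injective code.
  move=> u v; rewrite /code => h; apply/ffunP => j; apply: val_inj.
  move: j h; clear l u0 lu0 code; elim: q u v => [|q IH] u v j; first by case: j.
  rewrite !big_ord_recl /= expn0 !muln1.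
  have D0 : (0 < D)%N by apply: leq_ltn_trans (ltn_ord (u ord0)).
  have E (w : {ffun 'I_q.+1 -> 'I_D}) : (\sum_(i < q) w (lift ord0 i) * D ^ bump 0 i =
      (\sum_(i < q) [ffun i => w (lift ord0 i)] i * D ^ i) * D)%N.
    rewrite big_distrl /=; apply: eq_bigr => i _.
    by rewrite ffunE /bump /= add1n expnSr mulnA.
  rewrite !E => h.
  have h0 : u ord0 = v ord0 :> nat.
    by have := congr1 (modn^~ D) h; rewrite /= ![(_ + _ * D)%N]addnC !modnMDl !modn_small.
  have h1 : (\sum_(i < q) [ffun i => u (lift ord0 i)] i * D ^ i =
             \sum_(i < q) [ffun i => v (lift ord0 i)] i * D ^ i)%N.
    have := congr1 (divn^~ D) h.
    by rewrite /= ![(_ + _ * D)%N]addnC !divnMDl // !divn_small // !addn0.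
  case: (unliftP ord0 j) => [i ->|-> //].
  by have := IH _ _ i h1; rewrite !ffunE.
pose P : {poly F} := \sum_u l u *: 'X^(code u).
have P0 : P != 0.
  apply/eqP => /(congr1 (fun p : {poly F} => p`_(code u0))).
  rewrite coef0 coef_sum (bigD1 u0) //= coefZ coefXn eqxx mulr1 big1 => [|u uu0].
    by rewrite addr0; apply/eqP.
  rewrite coefZ coefXn; case: eqP => [/code_inj E|_]; last by rewrite mulr0.
  by rewrite E eqxx in uu0.
have [n Pn] := poly_nonroot P0.
exists (fun j => n%:R ^+ (D ^ j)); apply/eqP; apply: contraNN Pn => /eqP S0.
rewrite horner_sum -[X in _ == X]S0; apply/eqP; apply: eq_bigr => u _.
rewrite hornerZ hornerXn /code; congr (_ * _).
rewrite -prodrXr; apply: eq_bigr => j _.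
by rewrite mulnC exprM.
Qed.

End NonZero.

(** * Noetherianity *)

(** Each index is chosen where [u] attains its minimum over the tail that follows the previous
    index. *)
Lemma nondecreasing_subseq (u : nat -> nat) : exists s : nat -> nat,
  (forall i, (s i < s i.+1)%N) /\ (forall i, (u (s i) <= u (s i.+1))%N).
Proof.
have H (N : nat) : exists m, (N <= m)%N /\ forall l, (N <= l)%N -> (u m <= u l)%N.
  apply: NNPP => nH.
  (* Without a minimum, the values on the tail would exceed every natural number. *)
  have G v : forall m, (N <= m)%N -> (v < u m)%N.
    elim: v => [|v IH] m Nm; rewrite ltnNge; apply/negP => um; apply: nH.
      by exists m; split=> // l Nl; apply: leq_trans um _.
    by exists m; split=> // l /IH; apply: leq_trans.
  by have := G (u N) N (leqnn _); rewrite ltnn.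
pose f N := sval (constructive_indefinite_description _ (H N)).
have fP N : (N <= f N)%N /\ forall l, (N <= l)%N -> (u (f N) <= u l)%N.
  by rewrite /f; case: (constructive_indefinite_description _ _).
pose s := fix s i := if i is i'.+1 then f (s i').+1 else f 0%N.
have slt i : (s i < s i.+1)%N by case: (fP (s i).+1).
have [t [st ht]] : exists t, (forall i, s i = f (t i)) /\
    forall i, (t i <= s i)%N /\ (t i <= t i.+1)%N.
  exists (fun i => if i is i'.+1 then (s i').+1 else 0%N); split; first by case.
  case=> [|i] //=; split; first exact: slt.
  by rewrite ltnS ltnW // slt.
exists s; split=> // i; rewrite {1}st; apply: (fP (t i)).2.
by apply: leq_trans (ltnW (slt i)); case: (ht i).
Qed.

(** Subsequences are extracted successively so that one exponent after another becomes
    nondecreasing. *)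
Lemma dickson n (a : nat -> 'X_{1..n}) :
  exists i j, (i < j)%N /\ (a i <= a j)%MM.
Proof.
suff H (r : seq 'I_n) : exists s : nat -> nat, (forall i, (s i < s i.+1)%N) /\
    forall i t, t \in r -> (a (s i) t <= a (s i.+1) t)%N.
  have [s [slt sle]] := H (enum 'I_n).
  exists (s 0%N), (s 1%N); split=> //; apply/mnm_lepP => t.
  by apply: sle; rewrite mem_enum.
elim: r => [|t r [s [slt sle]]]; first by exists id.
have [s' [slt' sle']] := nondecreasing_subseq (fun i => a (s i) t).
exists (s \o s'); split=> [i|i t'] /=.
  by apply: (homo_ltn ltn_trans slt).
rewrite inE => /predU1P[->//|t'r].
apply: (homo_leq (f := fun i => a (s i) t') (r := leq)) => //.
- exact: leq_trans.
- by move=> k; apply: sle.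
- exact: ltnW.
Qed.

Section MPoly.
Variables (F : fieldType) (n : nat).

Lemma polyfun_meval (P : {mpoly F[n]}) : polyfun (fun v : 'I_n -> F => P.@[v]).
Proof.
have H : polyfun (fun v : 'I_n -> F =>
    \sum_(m <- msupp P) P@_m * \prod_i v i ^+ m i).
  apply: polyfun_sum => m _; apply: pf_mul; first exact: pf_cst.
  by apply: polyfun_prod => i _; apply: polyfun_exp; apply: pf_coord.
by apply: polyfun_ext H _ => v; rewrite mevalE.
Qed.

Lemma polyfun_mpoly (p : ('I_n -> F) -> F) :
  polyfun p -> exists P : {mpoly F[n]}, forall v, p v = P.@[v].
Proof.
elim=> [c|i|p1 p2 _ [P1 h1] _ [P2 h2]|p1 p2 _ [P1 h1] _ [P2 h2]].
- by exists c%:MP => v; rewrite mevalC.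
- by exists 'X_i => v; rewrite mevalXU.
- by exists (P1 + P2) => v; rewrite mevalD h1 h2.
- by exists (P1 * P2) => v; rewrite mevalM h1 h2.
Qed.

(** One step of polynomial division: the multiple of [P] is chosen to cancel the leading term of
    [Q]. *)
Lemma mlead_reduce (P Q : {mpoly F[n]}) : P != 0 -> Q != 0 ->
  (mlead P <= mlead Q)%MM ->
  exists R : {mpoly F[n]}, let Q' := Q - R * P in Q' = 0 \/ (mlead Q' < mlead Q)%O.
Proof.
move=> P0 Q0 le; pose d := (mlead Q - mlead P)%MM.
pose c := mleadc Q / mleadc P.
have cP0 : mleadc P != 0 by rewrite mleadc_eq0.
have c0 : c != 0 by rewrite mulf_neq0 ?invr_eq0 ?mleadc_eq0.
exists (c *: 'X_[d]) => Q'; have [->|Q'0] := eqVneq Q' 0; [by left|right].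
have C : (c *: 'X_[d] : {mpoly F[n]})@_d = c by rewrite mcoeffZ mcoeffX eqxx mulr1.
have L : mlead (c *: 'X_[d] : {mpoly F[n]}) = d.
  by rewrite mleadZ_proper ?mleadXm ?mcoeffX ?eqxx ?mulr1.
have cP : mleadc (c *: 'X_[d]) * mleadc P != 0 by rewrite L C mulf_neq0.
have E : mlead (c *: 'X_[d] * P) = mlead Q by rewrite mleadM_proper // L submK.
have le' : (mlead Q' <= mlead Q)%O.
  by apply: le_trans (mleadB_le _ _) _; rewrite E joinxx.
rewrite lt_neqAle le' andbT; apply/eqP => E'.
move: Q'0; rewrite -mleadc_eq0 E' => /negP; apply.
rewrite mcoeffB -{2}E mleadcM_proper // L C.
by rewrite /c divfK // subrr eqxx.
Qed.

(* The vanishing ideals of the tails [v_i, v_{i+1}, ...] would form a strictly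
   increasing chain. *)
Lemma no_infinite_descent (p : nat -> ('I_n -> F) -> F) (v : nat -> 'I_n -> F) :
  (forall i, polyfun (p i)) -> (forall i, p i (v i) <> 0) ->
  (forall i j, (i < j)%N -> p i (v j) = 0) -> False.
Proof.
move=> pp pv pv0.
pose J i (P : {mpoly F[n]}) := forall j, (i <= j)%N -> P.@[v j] = 0.
have JM i P Q : J i P -> J i (Q * P).
  by move=> h j ij; rewrite mevalM h ?mulr0.
have JB i P Q : J i P -> J i Q -> J i (P - Q).
  by move=> h h' j ij; rewrite mevalB h ?h' ?subr0.
have JB' i P Q : J i (P - Q) -> J i Q -> J i P.
  by move=> h h' j ij; have := h j ij; rewrite mevalB (h' j ij) subr0.
have Jle i j P : (i <= j)%N -> J i P -> J j P.
  by move=> ij h l jl; apply: h; apply: leq_trans jl.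
(* A member of [J i.+1] outside [J i] is taken with the least leading monomial. By Dickson's lemma
   one of these divides a later one in the leading monomial, and the reduction of the later one
   contradicts its minimality. *)
have ex i : exists P, [/\ J i.+1 P, ~ J i P &
    forall Q, J i.+1 Q -> ~ J i Q -> ~ (mlead Q < mlead P)%O].
  have [P hP] := polyfun_mpoly (pp i).
  have P1 : J i.+1 P by move=> j ij; rewrite -hP pv0.
  have P2 : ~ J i P by move=> /(_ i (leqnn _)); rewrite -hP; apply: pv.
  apply: NNPP => nex.
  suff H : forall m P, mlead P = m -> J i.+1 P -> ~ J i P -> False by exact: H P1 P2.
  apply: (well_founded_ind (@ltom_wf n)) => m IH {P1 P2 hP}P Pm P1 P2.
  apply: nex; exists P; split=> // Q Q1 Q2; rewrite Pm => lt.
  exact: IH lt _ _ Q1 Q2.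
pose q i := sval (constructive_indefinite_description _ (ex i)).
have qP i : [/\ J i.+1 (q i), ~ J i (q i) &
    forall Q, J i.+1 Q -> ~ J i Q -> ~ (mlead Q < mlead (q i))%O].
  by rewrite /q; case: (constructive_indefinite_description _ _).
have q0 i : q i != 0.
  by case: (qP i) => _ h _; apply/eqP => E; apply: h => j _; rewrite E meval0.
have [i [j [ij le]]] := dickson (fun i => mlead (q i)).
have [R HR] := mlead_reduce (q0 i) (q0 j) le.
have [qi1 _ _] := qP i; have [qj1 qj2 qjm] := qP j.
have Rj : J j (R * q i) by apply: JM; apply: Jle qi1.
have nJ : ~ J j (q j - R * q i) by move/JB' => /(_ Rj).
case: HR => [E|]; first by apply: nJ => l _; rewrite E meval0.
by apply: qjm nJ; apply: JB => //; apply: Jle Rj.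
Qed.

End MPoly.

(** * Algebraic dependence and coordinates *)

Section Counting.
Variables (F : numFieldType) (n : nat) (X : ('I_n -> F) -> Prop).

(** The relation is solved for its leading monomial, which on [X] thereby becomes a combination of
    smaller monomials. *)
Lemma coord_relation (q : nat) (g : 'I_q -> 'I_n) : injective g ->
  algdep X (fun j x => x (g j)) ->
  exists (m : 'X_{1..n}) (R : {mpoly F[n]}),
    [/\ forall j, j \notin codom g -> m j = 0%N,
        forall m', m' \in msupp R -> (m' < m)%O
      & forall x, X x -> 'X_[m].@[x] = R.@[x]].
Proof.
move=> g_inj [p [pp [v pv]] pX].
have [P hP] := polyfun_mpoly pp.
pose rho (a : 'X_{1..q}) : 'X_{1..n} := (\sum_i U_(g i) *+ a i)%MM.
pose Q : {mpoly F[n]} := \sum_(a <- msupp P) P@_a *: 'X_[rho a].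
have QE x : Q.@[x] = P.@[fun j => x (g j)].
  rewrite [RHS]mevalE /Q raddf_sum /=; apply: eq_bigr => a _.
  rewrite mevalZ /rho -mprodXnE rmorph_prod; congr (_ * _).
  by apply: eq_bigr => i _; rewrite rmorphXn /= mevalXU.
have Q0 : Q != 0.
  apply/eqP => Q0; apply: pv; rewrite hP.
  (* The point [v] is extended by 0 off the image of [g]. *)
  pose x j := if [pick i | g i == j] is Some i then v i else 0.
  have <- : (fun i => x (g i)) = v.
    apply: functional_extensionality => i; rewrite /x.
    by case: pickP => [i' /eqP/g_inj -> //|/(_ i)]; rewrite eqxx.
  by rewrite -QE Q0 meval0.
have c0 : mleadc Q != 0 by rewrite mleadc_eq0.
have supp m j : m \in msupp Q -> j \notin codom g -> m j = 0%N.
  rewrite mcoeff_msupp => Qm jg; apply/eqP; apply: contraNT Qm => mj.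
  rewrite /Q raddf_sum big1 //= => a _; rewrite mcoeffZ mcoeffX.
  case: eqP => [E|_]; last by rewrite mulr0.
  case/eqP: mj; rewrite -E /rho mnm_sumE big1 // => i _.
  rewrite mulmnE mnm1E; case: eqP => [gij|]; last by rewrite mul0n.
  by rewrite -gij codom_f in jg.
exists (mlead Q), ('X_[mlead Q] - (mleadc Q)^-1 *: Q); split.
- by move=> j; apply: supp; apply: mlead_supp.
- move=> m' m'R; rewrite lt_neqAle; apply/andP; split.
    apply: contraTneq m'R => ->.
    by rewrite mcoeff_msupp mcoeffB mcoeffX eqxx mcoeffZ mulVf // subrr eqxx.
  have := msuppB_le m'R; rewrite mem_cat msuppX inE => /orP[/eqP -> //|].
  by move/msuppZ_le; apply: msupp_le_mlead.
- by move=> x Xx; rewrite mevalB mevalZ QE -hP pX // mulr0 subr0.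
Qed.

(* Monomials with at most [e] exponents that are at least [A], of degree at
   most [D], listed by the truncations [s] of their exponents at [A] and the
   large exponents [l]. *)
Definition std_monomial (A e D : nat)
    (w : {ffun 'I_n -> 'I_A.+1} * {ffun 'I_e -> 'I_D.+1}) : 'X_{1..n} :=
  [multinom (if w.1 j < A then w.1 j : nat else
     nth 0%N [seq (w.2 t : nat) | t <- enum 'I_e]
        (index j (enum [pred i | w.1 i == A :> nat])))%N | j < n].

Lemma std_monomialP (A e D : nat) (m : 'X_{1..n}) : (mdeg m <= D)%N ->
  (#|[pred j | A <= m j]| <= e)%N -> exists w, @std_monomial A e D w = m.
Proof.
move=> mD me.
have mj j : (m j <= D)%N.
  by apply: leq_trans mD; rewrite mdegE (bigD1 j) //= leq_addr.
pose s : {ffun 'I_n -> 'I_A.+1} := [ffun j => inord (minn (m j) A)].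
have sE j : s j = minn (m j) A :> nat by rewrite ffunE inordK // ltnS geq_minr.
pose l : {ffun 'I_e -> 'I_D.+1} :=
  [ffun t : 'I_e => inord (nth 0%N [seq m j | j <- enum [pred j | (A <= m j)%N]] t)].
exists (s, l); apply/mnmP => j; rewrite mnmE /= sE.
have -> : enum [pred i | s i == A :> nat] = enum [pred j | (A <= m j)%N].
  by apply: eq_enum => i; rewrite !inE sE; apply/eqP/minn_idPr.
case: (boolP (m j < A)%N) => [lt|]; first by rewrite (minn_idPl (ltnW lt)) lt.
rewrite -leqNgt => le.
rewrite (minn_idPr le) ltnn.
have jin : j \in enum [pred j | (A <= m j)%N] by rewrite mem_enum.
have lte : (index j (enum [pred j | (A <= m j)%N]) < e)%N.
  by apply: leq_trans me; rewrite cardE index_mem.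
rewrite (nth_map (Ordinal lte)) ?size_enum_ord // ffunE nth_enum_ord //.
rewrite (nth_map j) ?index_mem // nth_index // inordK // ltnS; exact: mj.
Qed.

Definition std_span (A e D : nat) (h : ('I_n -> F) -> F) : Prop :=
  exists c : {ffun 'I_n -> 'I_A.+1} * {ffun 'I_e -> 'I_D.+1} -> F,
    forall x, X x -> h x = \sum_w c w * 'X_[std_monomial w].@[x].

Lemma std_span_mpoly (A e D : nat) (P : {mpoly F[n]}) :
  (forall m, m \in msupp P -> std_span A e D (fun x => 'X_[m].@[x])) ->
  std_span A e D (fun x => P.@[x]).
Proof.
move=> H.
have /fin_all_exists[c hc] (i : 'I_(size (msupp P))) : exists c, forall x, X x ->
    'X_[nth 0%MM (msupp P) i].@[x] = \sum_w c w * 'X_[@std_monomial A e D w].@[x].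
  by apply: H; rewrite mem_nth.
exists (fun w => \sum_(i < size (msupp P)) P@_(nth 0%MM (msupp P) i) * c i w) => x Xx.
rewrite {1}(mpolyE P) raddf_sum /= (big_nth 0%MM) big_mkord.
transitivity (\sum_(i < size (msupp P)) \sum_w
    P@_(nth 0%MM (msupp P) i) * c i w * 'X_[std_monomial w].@[x]).
  apply: eq_bigr => i _; rewrite mevalZ hc // big_distrr /=.
  by apply: eq_bigr => w _; rewrite mulrA.
by rewrite exchange_big /=; apply: eq_bigr => w _; rewrite big_distrl.
Qed.

(** [A] bounds all exponents of the leading monomials [mu g]. A monomial with more than [e]
    exponents at least [A] is divisible by some [mu g], so on [X] it is a combination of smaller
    monomials, and well-founded induction applies. *)
Lemma std_span_monomials (e : nat) :
  (forall g : 'I_e.+1 -> 'I_n, injective g -> algdep X (fun j x => x (g j))) ->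
  exists A, forall D m, (mdeg m <= D)%N -> std_span A e D (fun x => 'X_[m].@[x]).
Proof.
move=> Xe.
have /fin_all_exists[mu hmu] (g : {ffun 'I_e.+1 -> 'I_n}) :
    exists m : 'X_{1..n}, injective g -> exists (R : {mpoly F[n]}),
    [/\ forall j, j \notin codom g -> m j = 0%N,
        forall m', m' \in msupp R -> (m' < m)%O
      & forall x, X x -> 'X_[m].@[x] = R.@[x]].
  have [gi|ng] := classic (injective g); last by exists 0%MM.
  by have [m Hm] := coord_relation gi (Xe g gi); exists m.
pose A := (\max_g \max_j mu g j)%N; exists A => D.
have muA g j : (mu g j <= A)%N.
  by apply: leq_trans (leq_bigmax g); apply: leq_trans (leq_bigmax j).
apply: (well_founded_ind (@ltom_wf n)) => m IH mD.
have [me|em] := leqP #|[pred j | A <= m j]%N| e.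
  have [w0 E] := std_monomialP mD me.
  exists (fun w => (w == w0)%:R) => x _.
  rewrite (bigD1 w0) //= eqxx mul1r E big1 ?addr0 // => w /negPf ->.
  by rewrite mul0r.
set B := [pred j | A <= m j]%N in em.
pose g : {ffun 'I_e.+1 -> 'I_n} := [ffun t => enum_val (widen_ord em t)].
have gi : injective g.
  by move=> t u; rewrite !ffunE => /enum_val_inj/(congr1 val)/= /val_inj.
have gA t : (A <= m (g t))%N by have := enum_valP (widen_ord em t); rewrite ffunE.
have [R [h1 h2 h3]] := hmu g gi.
have le : (mu g <= m)%MM.
  apply/mnm_lepP => j; case jg: (j \in codom g); last by rewrite h1 ?jg.
  by have /codomP[t ->] := jg; apply: leq_trans (gA t).
have -> : (fun x : 'I_n -> F => 'X_[m].@[x]) =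
    fun x => 'X_[(m - mu g)%MM].@[x] * 'X_[mu g].@[x].
  by apply: functional_extensionality => x; rewrite -mevalM -mpolyXD submK.
have [c hc] : std_span A e D (fun x => (R * 'X_[m - mu g]).@[x]).
  apply: std_span_mpoly => m'; rewrite (perm_mem (msuppMX _ _)) => /mapP[m1 m1R ->].
  have lt : ((m - mu g + m1)%MM < m)%O.
    by rewrite -{2}(submK le) ltmc_add2r h2.
  (* The monomial order refines the degree, so the reduction stays within degree [D]. *)
  by apply: IH => //; apply: leq_trans mD; apply/lemc_mdeg/ltW.
by exists c => x Xx; rewrite h3 // mulrC -mevalM hc.
Qed.

Lemma msizeM_leq a b (P Q : {mpoly F[n]}) :
  (msize P <= a.+1)%N -> (msize Q <= b.+1)%N -> (msize (P * Q)%R <= (a + b).+1)%N.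
Proof.
have [->|P0] := eqVneq P 0; first by rewrite mul0r msize0.
have [->|Q0] := eqVneq Q 0; first by rewrite mulr0 msize0.
rewrite msizeM // (mpolySpred _ P0) (mpolySpred _ Q0) !ltnS => Pa Qb.
by rewrite addnS /= ltnS leq_add.
Qed.

(** The products of powers of the [f j] with exponents below [D] number D^(e+1), while on [X] they
    lie in a span of O(D^e) standard monomials; for large [D] they satisfy a linear relation. *)
Lemma algdep_of_coords (e : nat) :
  (forall g : 'I_e.+1 -> 'I_n, injective g -> algdep X (fun j x => x (g j))) ->
  forall f : 'I_e.+1 -> ('I_n -> F) -> F, (forall j, polyfun (f j)) -> algdep X f.
Proof.
move=> /std_span_monomials[A HA] f pf.
have /fin_all_exists[G hG] j := polyfun_mpoly (pf j).
pose d := (\max_j msize (G j))%N.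
have Gd j : (msize (G j) <= d.+1)%N by apply: leq_trans (leqnSn d); apply: (leq_bigmax j).
(* [K] is chosen so that the standard monomials of degree at most [D'] number at most K D^e, which
   is less than D^(e+1) once D = K + 1. *)
pose q := e.+1; pose K := (A.+1 ^ n * (d * q).+1 ^ e)%N; pose D := K.+1.
pose D' := (d * q * D)%N.
pose U := {ffun 'I_q -> 'I_D}.
pose W := ({ffun 'I_n -> 'I_A.+1} * {ffun 'I_e -> 'I_D'.+1})%type.
have WU : (#|{: W}| < #|{: U}|)%N.
  rewrite card_prod !card_ffun !card_ord.
  have le1 : (D'.+1 <= (d * q).+1 * D)%N by rewrite /D' mulSn -add1n leq_add2r.
  have le2 : (A.+1 ^ n * D'.+1 ^ e <= K * D ^ e)%N.
    rewrite /K -mulnA -expnMn leq_mul2l; apply/orP; right.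
    by elim: (e) => // k IH; rewrite !expnS leq_mul.
  apply: leq_ltn_trans le2 _; rewrite /q expnS ltn_mul2r ltnSn andbT.
  by rewrite expn_gt0.
have /fin_all_exists[c hc] (u : U) : exists c : W -> F, forall x, X x ->
    \prod_j f j x ^+ u j = \sum_w c w * 'X_[std_monomial w].@[x].
  have [|c hc] := @std_span_mpoly A e D' (\prod_j G j ^+ u j).
    move=> m /msize_mdeg_lt mP; apply: HA; rewrite -ltnS; apply: leq_trans mP _.
    have Hexp j k : (msize (G j ^+ k)%R <= (d * k).+1)%N.
      elim: k => [|k IH]; first by rewrite expr0 msize1.
      by rewrite exprS mulnS; apply: msizeM_leq.
    have -> : D' = (\sum_(j < q) d * D)%N.
      by rewrite sum_nat_const card_ord /D' mulnCA mulnA.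
    elim/big_rec2: _ => [|j a P _ IH]; first by rewrite msize1.
    apply: msizeM_leq => //; apply: leq_trans (Hexp _ _) _.
    by rewrite ltnS leq_mul2l ltnW ?orbT.
  exists c => x Xx; rewrite -hc // rmorph_prod; apply: eq_bigr => j _.
  by rewrite rmorphXn hG.
pose C : 'M[F]_(#|{: U}|, #|{: W}|) := \matrix_(u, w) c (enum_val u) (enum_val w).
have /rowV0Pn[l /sub_kermxP lC l0] : kermx C != 0.
  rewrite kermx_eq0 /row_free neq_ltn; apply/orP; left.
  by apply: leq_ltn_trans (rank_leq_col _) WU.
pose L (u : U) := l 0 (enum_rank u).
exists (fun y => \sum_u L u * \prod_j y j ^+ u j).
  split.
    apply: polyfun_sum => u _; apply: pf_mul; first exact: pf_cst.
    by apply: polyfun_prod => j _; apply: polyfun_exp; apply: pf_coord.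
  apply: polyfun_sum_monomials_neq0.
  have /rV0Pn[i li] := l0.
  by exists (enum_val i); rewrite /L enum_valK.
move=> x Xx; under eq_bigr => u _ do rewrite hc // big_distrr /=.
rewrite exchange_big big1 //= => w _.
have := congr1 (fun M : 'rV_ _ => M 0 (enum_rank w)) lC; rewrite !mxE => E.
transitivity ((\sum_j l 0 j * C j (enum_rank w)) * 'X_[std_monomial w].@[x]);
  last by rewrite E mul0r.
rewrite big_distrl /=.
rewrite (reindex enum_rank) /=; last by apply: onW_bij; apply: enum_rank_bij.
by apply: eq_bigr => u _; rewrite mxE !enum_rankK mulrA.
Qed.

End Counting.

Lemma algdep_of_coords_fin (F : numFieldType) (T I : finType)
    (X : (T -> F) -> Prop) :
  (forall g : I -> T, injective g -> algdep X (fun j x => x (g j))) ->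
  forall f : I -> (T -> F) -> F, (forall j, polyfun (f j)) -> (0 < #|I|)%N ->
  algdep X f.
Proof.
move=> Xe f pf I0.
have Ie : #|I| = #|I|.-1.+1 by rewrite prednK.
pose a (j : 'I_#|I|.-1.+1) : I := enum_val (cast_ord (esym Ie) j).
pose b (i : I) : 'I_#|I|.-1.+1 := cast_ord Ie (enum_rank i).
have ab i : a (b i) = i by rewrite /a /b cast_ordK enum_rankK.
have ba j : b (a j) = j by rewrite /a /b enum_valK cast_ordKV.
pose tX (y : 'I_#|T| -> F) := X (fun t => y (enum_rank t)).
have H (g : 'I_#|I|.-1.+1 -> 'I_#|T|) : injective g ->
    algdep tX (fun j x => x (g j)).
  move=> gi; have [|P [pP [v Pv]] hP] := Xe (fun i => enum_val (g (b i))).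
    by move=> i i' /enum_val_inj/gi/(congr1 a); rewrite !ab.
  exists (fun y => P (fun i => y (b i))).
    split; first by apply: polyfun_comp pP _ => i; apply: pf_coord.
    exists (fun j => v (a j)).
    have -> // : (fun i => v (a (b i))) = v.
    by apply: functional_extensionality => i; rewrite ab.
  move=> x Xx; rewrite -[RHS](hP _ Xx); congr P.
  by apply: functional_extensionality => i; rewrite enum_valK.
have [|P [pP [v Pv]] hP] := algdep_of_coords H (f := fun j y => f (a j) (fun t => y (enum_rank t))).
  by move=> j; apply: polyfun_comp (pf _) _ => i; apply: pf_coord.
exists (fun y => P (fun j => y (a j))).
  split; first by apply: polyfun_comp pP _ => i; apply: pf_coord.
  exists (fun i => v (b i)).
  have -> // : (fun j => v (b (a j))) = v.
  by apply: functional_extensionality => i; rewrite ba.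
move=> x Xx; pose y (i : 'I_#|T|) := x (enum_val i).
have yE : (fun t => y (enum_rank t)) = x.
  by apply: functional_extensionality => i; rewrite /y enum_rankK.
by have := hP y; rewrite /tX yE => /(_ Xx).
Qed.

(** * Images of closed sets *)

Section ZariskiNoetherian.
Variables (F : fieldType) (T : finType).

Lemma no_infinite_descent_fin (p : nat -> (T -> F) -> F) (v : nat -> T -> F) :
  (forall i, polyfun (p i)) -> (forall i, p i (v i) <> 0) ->
  (forall i j, (i < j)%N -> p i (v j) = 0) -> False.
Proof.
move=> pp pv pv0.
have vE i : (fun t => v i (enum_val (enum_rank t))) = v i.
  by apply: functional_extensionality => t; rewrite enum_rankK.
apply: (@no_infinite_descent F #|T| (fun i y => p i (fun t => y (enum_rank t)))
  (fun i j => v i (enum_val j))).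
- by move=> i; apply: polyfun_comp (pp i) _ => t; apply: pf_coord.
- by move=> i; rewrite vE.
- by move=> i j ij; rewrite vE; apply: pv0.
Qed.

(** Otherwise every finite part of [S] has a common zero where another member of [S] is nonzero;
    adjoining such members repeatedly contradicts [no_infinite_descent_fin]. *)
Lemma zclosed_finite (Y : (T -> F) -> Prop) : zclosed Y ->
  exists ps : seq ((T -> F) -> F), (forall p, List.In p ps -> polyfun p) /\
    forall x, Y x <-> forall p, List.In p ps -> p x = 0.
Proof.
move=> [S [Sp YS]]; apply: NNPP => nfin.
have step (ps : seq ((T -> F) -> F)) : exists px : ((T -> F) -> F) * (T -> F),
    (forall p, List.In p ps -> S p) ->
    [/\ S px.1, px.1 px.2 <> 0 & forall p, List.In p ps -> p px.2 = 0].
  have [psS|nS] := classic (forall p, List.In p ps -> S p); last first.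
    by exists ((fun=> 0), (fun=> 0)) => /nS.
  apply: NNPP => nx; apply: nfin; exists ps; split=> [p /psS/Sp //|x].
  split=> [/YS h p /psS/h //|h]; apply/YS => p pS; apply: NNPP => px.
  by apply: nx; exists (p, x).
pose f ps := sval (constructive_indefinite_description _ (step ps)).
have fP ps : (forall p, List.In p ps -> S p) ->
    [/\ S (f ps).1, (f ps).1 (f ps).2 <> 0 & forall p, List.In p ps -> p (f ps).2 = 0].
  by rewrite /f; case: (constructive_indefinite_description _ _).
pose L := fix L i := if i is i'.+1 then (f (L i')).1 :: L i' else [::].
have LS i p : List.In p (L i) -> S p.
  by elim: i p => //= i IH p [<-|/IH //]; case: (fP (L i) IH).
apply: (@no_infinite_descent_fin (fun i => (f (L i)).1) (fun i => (f (L i)).2)).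
- by move=> i; apply: Sp; case: (fP _ (@LS i)).
- by move=> i; case: (fP _ (@LS i)).
- move=> i j ij; have [_ _] := fP _ (@LS j); apply.
  elim: j ij => // j IH; rewrite ltnS leq_eqVlt => /predU1P[->|/IH h]; first by left.
  by right.
Qed.

(** Without a minimal set there is an infinite strictly descending chain. Points lost at each step,
    with equations of the next set that do not vanish at them, form a forbidden sequence. *)
Lemma zclosed_minimal (Pr : ((T -> F) -> Prop) -> Prop) (Y : (T -> F) -> Prop) :
  zclosed Y -> Pr Y ->
  exists Z, [/\ zclosed Z, Pr Z, forall x, Z x -> Y x &
    forall Z', zclosed Z' -> Pr Z' -> (forall x, Z' x -> Z x) ->
      forall x, Z x -> Z' x].
Proof.
move=> Yc YP; apply: NNPP => nmin.
pose sub := {Z | [/\ zclosed Z, Pr Z & forall x, Z x -> Y x]}.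
have step (Z : sub) : exists Zx : sub * (T -> F),
    [/\ forall x, sval Zx.1 x -> sval Z x, sval Z Zx.2 & ~ sval Zx.1 Zx.2].
  case: Z => Z [Zc ZP ZY] /=; apply: NNPP => nx; apply: nmin; exists Z; split=> //.
  move=> Z' Z'c Z'P Z'Z x Zx; apply: NNPP => Z'x; apply: nx.
  have Z'3 : [/\ zclosed Z', Pr Z' & forall x, Z' x -> Y x].
    by split=> // y /Z'Z/ZY.
  by exists (exist _ Z' Z'3, x).
pose f Z := sval (constructive_indefinite_description _ (step Z)).
have fP Z : [/\ forall x, sval (f Z).1 x -> sval Z x, sval Z (f Z).2
    & ~ sval (f Z).1 (f Z).2].
  by rewrite /f; case: (constructive_indefinite_description _ _).
have Y3 : [/\ zclosed Y, Pr Y & forall x, Y x -> Y x] by [].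
pose Z := fix Z i : sub := if i is i'.+1 then (f (Z i')).1 else exist _ Y Y3.
have Zle i j : (i <= j)%N -> forall x, sval (Z j) x -> sval (Z i) x.
  move=> ij x; elim: j ij => [|j IH]; first by rewrite leqn0 => /eqP ->.
  by rewrite leq_eqVlt => /predU1P[->//|/IH h] h'; apply: h; case: (fP (Z j)) => + _ _; apply.
have ex i : exists p, [/\ polyfun p, p (f (Z i)).2 <> 0 &
    forall x, sval (Z i.+1) x -> p x = 0].
  have [_ _ nZ] := fP (Z i); have [[S [Sp ZS]] _ _] := svalP (Z i.+1).
  apply: NNPP => nex; apply: nZ; apply/ZS => p pS; apply: NNPP => px.
  apply: nex; exists p; split; [exact: Sp|by []|].
  by move=> x /ZS; apply.
pose p i := sval (constructive_indefinite_description _ (ex i)).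
have pP i : [/\ polyfun (p i), p i (f (Z i)).2 <> 0 &
    forall x, sval (Z i.+1) x -> p i x = 0].
  by rewrite /p; case: (constructive_indefinite_description _ _).
apply: (@no_infinite_descent_fin p (fun i => (f (Z i)).2)) => [i|i|i j ij].
- by case: (pP i).
- by case: (pP i).
- have [_ _ h] := pP i; apply: h; apply: Zle ij _ _.
  by case: (fP (Z j)).
Qed.

End ZariskiNoetherian.

(** * Quantifier elimination and projections *)

Section Chevalley.
Variable F : numClosedFieldType.
Implicit Types (T : finType).

Definition point_env n (v : 'I_n -> F) : seq F := [seq v j | j <- enum 'I_n].

Lemma nth_point_env n (v : 'I_n -> F) (j : 'I_n) : nth 0 (point_env v) j = v j.
Proof. by rewrite (nth_map j) ?size_enum_ord // nth_ord_enum. Qed.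

Lemma polyfun_eval n (t : GRing.term F) : GRing.rterm t ->
  polyfun (fun v : 'I_n -> F => GRing.eval (point_env v) t).
Proof.
elim: t => //=.
- move=> i _; case: (ltnP i n) => ni.
    apply: polyfun_ext (pf_coord _ (Ordinal ni)) _ => v.
    by rewrite -(nth_point_env v (Ordinal ni)).
  apply: polyfun_ext (pf_cst _ 0) _ => v.
  by rewrite nth_default // size_map size_enum_ord.
- by move=> c _; apply: pf_cst.
- by move=> c _; apply: pf_cst.
- by move=> t1 IH1 t2 IH2 /andP[/IH1 h1 /IH2 h2]; apply: pf_add.
- by move=> t IH /IH h; apply: polyfun_opp.
- move=> t IH k /IH h; apply: polyfun_ext (pf_mul (pf_cst _ k%:R) h) _ => v.
  by rewrite mulr_natl.
- by move=> t1 IH1 t2 IH2 /andP[/IH1 h1 /IH2 h2]; apply: pf_mul.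
- by move=> t IH k /IH h; apply: polyfun_exp.
Qed.

(** An equation either holds identically or fails off a hypersurface; for a binary connective the
    two hypersurfaces are united by multiplying their equations. *)
Lemma qf_eval_generic n (f : GRing.formula F) : GRing.qf_form f -> GRing.rformula f ->
  exists (h : ('I_n -> F) -> F) b, [/\ polyfun h, exists v, h v <> 0 &
    forall v, h v <> 0 -> GRing.qf_eval (point_env v) f = b].
Proof.
have triv (b : bool) : exists (h : ('I_n -> F) -> F) b', [/\ polyfun h, exists v, h v <> 0 &
    forall v, h v <> 0 -> b = b'].
  exists (fun=> 1), b; split=> //; first exact: pf_cst.
  by exists (fun=> 0); apply/eqP; apply: oner_neq0.
have bin (op : bool -> bool -> bool) f1 f2 :
    (exists (h : ('I_n -> F) -> F) b, [/\ polyfun h, exists v, h v <> 0 &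
    forall v, h v <> 0 -> GRing.qf_eval (point_env v) f1 = b]) ->
    (exists (h : ('I_n -> F) -> F) b, [/\ polyfun h, exists v, h v <> 0 &
    forall v, h v <> 0 -> GRing.qf_eval (point_env v) f2 = b]) ->
    exists (h : ('I_n -> F) -> F) b, [/\ polyfun h, exists v, h v <> 0 &
    forall v, h v <> 0 ->
      op (GRing.qf_eval (point_env v) f1) (GRing.qf_eval (point_env v) f2) = b].
  move=> [h1 [b1 [p1 n1 e1]]] [h2 [b2 [p2 n2 e2]]].
  exists (fun v => h1 v * h2 v), (op b1 b2); split; first exact: pf_mul.
    have [v [/eqP v1 /eqP v2]] := polyfun_mul_neq0 p1 p2 n1 n2.
    by exists v; apply/eqP; rewrite mulf_neq0.
  move=> v /eqP; rewrite mulf_eq0 => /norP[/eqP v1 /eqP v2].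
  by rewrite e1 ?e2.
elim: f => //=.
- move=> t1 t2 _ /andP[r1 r2].
  have pd : polyfun (fun v : 'I_n -> F => GRing.eval (point_env v) t1 - GRing.eval (point_env v) t2).
    by apply: pf_add; [|apply: polyfun_opp]; apply: polyfun_eval.
  have [nz|z] := classic (exists v : 'I_n -> F,
      GRing.eval (point_env v) t1 - GRing.eval (point_env v) t2 <> 0).
    exists (fun v => GRing.eval (point_env v) t1 - GRing.eval (point_env v) t2), false; split=> //.
    by move=> v /eqP; rewrite subr_eq0 => /negPf.
  exists (fun=> 1), true; split=> [||v _]; first exact: pf_cst.
    by exists (fun=> 0); apply/eqP; apply: oner_neq0.
  by rewrite -subr_eq0; apply: contra_notT z => /eqP nz; exists v.
- by move=> f1 IH1 f2 IH2 /andP[/IH1 q1 /IH2 q2] /andP[/q1 h1 /q2 h2]; apply: (bin andb).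
- by move=> f1 IH1 f2 IH2 /andP[/IH1 q1 /IH2 q2] /andP[/q1 h1 /q2 h2]; apply: (bin orb).
- by move=> f1 IH1 f2 IH2 /andP[/IH1 q1 /IH2 q2] /andP[/q1 h1 /q2 h2]; apply: (bin implb).
- move=> f IH /IH q /q [h [b [p n' e]]].
  by exists h, (~~ b); split=> // v /e ->.
Qed.

(** The offset [k] reserves the first [k] variables for the coordinates of an image point. *)
Lemma polyfun_term T k (p : (T -> F) -> F) : polyfun p ->
  exists2 t : GRing.term F, GRing.rterm t &
    forall e, GRing.eval e t = p (fun s => e`_(k + enum_rank s)).
Proof.
elim=> [c|s|p1 p2 _ [t1 r1 h1] _ [t2 r2 h2]|p1 p2 _ [t1 r1 h1] _ [t2 r2 h2]].
- by exists (GRing.Const c).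
- by exists (GRing.Var F (k + enum_rank s)).
- by exists (GRing.Add t1 t2) => [|e] /=; rewrite ?r1 ?h1 ?h2.
- by exists (GRing.Mul t1 t2) => [|e] /=; rewrite ?r1 ?h1 ?h2.
Qed.

(* The image is defined by a quantifier-free formula, whose truth value is
   constant off a hypersurface. *)
Lemma dense_image T (Y : (T -> F) -> Prop) e (g : 'I_e -> T) :
  zclosed Y -> ~ algdep Y (fun j x => x (g j)) ->
  exists h : ('I_e -> F) -> F, [/\ polyfun h, exists v, h v <> 0 &
    forall v, h v <> 0 -> exists2 y, Y y & forall j, y (g j) = v j].
Proof.
move=> /zclosed_finite[ps [pps YE]] dense.
have [f1 [rf1 hf1]] : exists f1 : GRing.formula F, GRing.rformula f1 /\
    forall en, GRing.holds en f1 <-> Y (fun s => en`_(e + enum_rank s)).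
  suff [f1 [r1 h1]] : exists f1 : GRing.formula F, GRing.rformula f1 /\
      forall en, GRing.holds en f1 <->
        forall p, List.In p ps -> p (fun s => en`_(e + enum_rank s)) = 0.
    by exists f1; split=> // en; rewrite h1 YE.
  elim: ps pps {YE} => [|p ps IH] pps.
    by exists (GRing.Bool true); split.
  have [q|f1 [r1 h1]] := IH; first by move=> qps; apply: pps; right.
  have [t rt ht] := polyfun_term e (pps p (or_introl erefl)).
  exists (GRing.And (GRing.Equal t (GRing.Const 0)) f1); split; first by rewrite /= rt.
  move=> en; rewrite /= ht h1; split=> [[p0 H] q [<- //|]|H]; first exact: H.
  by split=> [|q qs]; apply: H; [left|right].
pose c (j : 'I_e) : GRing.formula F :=
  GRing.Equal (GRing.Var F j) (GRing.Var F (e + enum_rank (g j))).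
pose f2 := foldr (fun j => GRing.And (c j)) (GRing.Bool true) (enum 'I_e).
have rf2 : GRing.rformula f2 by rewrite /f2; elim: (enum 'I_e).
have hf2 en : GRing.holds en f2 <-> forall j : 'I_e, en`_j = en`_(e + enum_rank (g j)).
  suff H s : GRing.holds en (foldr (fun j => GRing.And (c j)) (GRing.Bool true) s) <-> forall j, j \in s -> en`_j = en`_(e + enum_rank (g j)).
    by rewrite H; split=> h j; [apply: h; rewrite mem_enum | move=> _].
  elim: s => [|i s IH] /=; first by split.
  rewrite IH; split=> [[E H] j|H]; first by rewrite inE => /predU1P[->|/H].
  by split=> [|j js]; apply: H; rewrite inE ?eqxx ?js ?orbT.
(* The variables below [e] hold the image point; those from [e] on hold the point of [Y] and are
   quantified. *)
pose vars := iota e #|T|.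
pose f := foldr (GRing.Exists (R:=F)) (GRing.And f1 f2) vars.
have rf : GRing.rformula f by rewrite /f; elim: (vars) => //=; rewrite rf1 rf2.
have hf v : GRing.holds (point_env v) f <-> exists2 y, Y y & forall j, y (g j) = v j.
  rewrite /f -GRing.foldExistsP; split=> [[en same /= [/hf1 Yen /hf2 E]]|[y Yy yg]].
    exists (fun s => en`_(e + enum_rank s)) => // j; rewrite -E -same ?nth_point_env //.
    by rewrite inE mem_iota leqNgt ltn_ord.
  pose en := point_env v ++ [seq y s | s <- enum T].
  have szv : size (point_env v) = e by rewrite size_map size_enum_ord.
  have enT : (fun s => en`_(e + enum_rank s)) = y.
    apply: functional_extensionality => s; rewrite /en nth_cat szv ltnNge leq_addr /=.
    by rewrite addKn (nth_map s) -?cardE // nth_enum_rank.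
  exists en => [i|].
    rewrite inE mem_iota negb_and -ltnNge -leqNgt /en nth_cat szv => /orP[->//|le].
    have ei : (e <= i)%N by apply: leq_trans le; apply: leq_addr.
    by rewrite ltnNge ei /= !nth_default ?szv // size_map -cardE leq_subRL.
  split; first by apply/hf1; rewrite enT.
  apply/hf2 => j; rewrite -[RHS]/((fun s => en`_(e + enum_rank s)) (g j)) enT yg.
  by rewrite /en nth_cat szv ltn_ord nth_point_env.
have acl : GRing.closed_field_axiom F by exact: solve_monicpoly.
have QE := GRing.quantifier_elim_rformP (@ClosedFieldQE.wf_ex_elim F)
  (ClosedFieldQE.holds_ex_elim acl).
have qP v := QE (point_env v) f rf.
have /andP[qq rq] := GRing.quantifier_elim_wf (@ClosedFieldQE.wf_ex_elim F) rf.
have [h [b [ph nh hb]]] := qf_eval_generic e qq rq.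
exists h; split=> // v hv; apply/hf/qP; rewrite hb //.
(* If the generic truth value were false, [h] would vanish on the whole image of [Y] and be a
   relation among the coordinates. *)
apply: NNPP => nb; apply: dense; exists h; first by split.
move=> y Yy; apply: NNPP => hy; apply: nb; rewrite -(hb _ hy).
by apply/qP/hf; exists y.
Qed.

End Chevalley.

(** * Chains of irreducible closed sets *)

Section Chains.
Variables (F : numClosedFieldType) (T : finType).
Implicit Types (X Y Z : (T -> F) -> Prop).

Lemma algdepS I X Y (f : I -> (T -> F) -> F) :
  (forall x, X x -> Y x) -> algdep Y f -> algdep X f.
Proof. by move=> XY [P hP h]; exists P => // x /XY; apply: h. Qed.

Lemma algdepU I X Y Z (f : I -> (T -> F) -> F) :
  (forall x, Z x -> X x \/ Y x) -> algdep X f -> algdep Y f -> algdep Z f.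
Proof.
move=> ZXY [P [pP nP] hP] [Q [pQ nQ] hQ]; exists (fun v => P v * Q v).
  split; first exact: pf_mul.
  have [v [/eqP v1 /eqP v2]] := polyfun_mul_neq0 pP pQ nP nQ.
  by exists v; apply/eqP; rewrite mulf_neq0.
by move=> x /ZXY[/hP ->|/hQ ->]; rewrite ?mul0r ?mulr0.
Qed.

Lemma not_algdep_nonempty I X (f : I -> (T -> F) -> F) :
  ~ algdep X f -> exists x, X x.
Proof.
move=> nX; apply: NNPP => X0; apply: nX; exists (fun=> 1); last first.
  by move=> x Xx; case: X0; exists x.
split; first exact: pf_cst.
by exists (fun=> 0); apply/eqP; apply: oner_neq0.
Qed.

(** A minimal closed subset on which the coordinates stay independent is irreducible: were they
    dependent on both parts of a decomposition, the product of the two relations would hold on the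
    union. *)
Lemma zirreducible_dense e (g : 'I_e -> T) Y : zclosed Y ->
  ~ algdep Y (fun j x => x (g j)) ->
  exists Z, [/\ zirreducible Z, forall x, Z x -> Y x &
    ~ algdep Z (fun j x => x (g j))].
Proof.
move=> Yc /(zclosed_minimal Yc (Pr := fun Z => ~ algdep Z (fun j x => x (g j)))).
move=> [Z [Zc Zd ZY Zmin]]; exists Z; split=> //; split=> //.
  by have [x Zx] := not_algdep_nonempty Zd; exists x.
move=> Z1 Z2 c1 c2 ZE.
have [d1|d1] := classic (algdep Z1 (fun j x => x (g j))).
  have d2 : ~ algdep Z2 (fun j x => x (g j)).
    by move=> d2; apply: Zd; apply: algdepU d1 d2 => x /ZE.
  right=> x; split=> [h|]; first by apply/ZE; right.
  by apply: Zmin => // y h; apply/ZE; right.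
left=> x; split=> [h|]; first by apply/ZE; left.
by apply: Zmin => // y h; apply/ZE; left.
Qed.

Lemma zclosed_slice Y (t : T) (c : F) : zclosed Y -> zclosed (fun y => Y y /\ y t = c).
Proof.
move=> [S [Sp YS]]; exists (fun p => S p \/ p = fun y => y t - c); split.
  move=> p [/Sp //|->]; apply: polyfun_ext (pf_add (pf_coord F t) (pf_cst T (- c))) _.
  by [].
move=> x; split=> [[/YS h xt] p [/h //|->]|h]; first by rewrite xt subrr.
split; first by apply/YS => p pS; apply: h; left.
by apply/eqP; rewrite -subr_eq0; apply/eqP; apply: (h (fun y => y t - c)); right.
Qed.

(** The image of [Y] contains all points with [h] nonzero. For [c] the first coordinate of such a
    point, [h] is not identically zero on that hyperplane, so the other coordinates still have dense
    image on the slice. *)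
Lemma slice_dense e (g : 'I_e.+1 -> T) Y : zclosed Y ->
  ~ algdep Y (fun j x => x (g j)) ->
  exists c, ~ algdep (fun y => Y y /\ y (g ord0) = c)
    (fun j x => x (g (lift ord0 j))).
Proof.
move=> Yc /(dense_image Yc)[h [ph [w hw] himg]].
exists (w ord0) => -[P [pP [u Pu]] hP].
pose cons (v : 'I_e -> F) j := if unlift ord0 j is Some j' then v j' else w ord0.
have pcons j : polyfun (fun v => cons v j).
  rewrite /cons; case: unliftP => [j' _|_]; [exact: pf_coord | exact: pf_cst].
have nh : exists v, h (cons v) <> 0.
  exists (fun j => w (lift ord0 j)).
  have -> // : cons (fun j => w (lift ord0 j)) = w.
  by apply: functional_extensionality => j; rewrite /cons; case: unliftP => [j' ->|->].
have [v [Pv hv]] := polyfun_mul_neq0 pP (polyfun_comp ph pcons) (ex_intro _ u Pu) nh.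
have [y Yy yg] := himg _ hv.
apply: Pv; have <- : (fun j => y (g (lift ord0 j))) = v.
  by apply: functional_extensionality => j; rewrite yg /cons liftK.
by apply: hP; rewrite yg /cons unlift_none.
Qed.

(** An irreducible [Z] is put on top of a chain inside a slice of [Z]. The inclusion is strict
    because the sliced coordinate is not constant on [Z]. *)
Lemma chain_of_dense e (g : 'I_e -> T) Y : zclosed Y ->
  ~ algdep Y (fun j x => x (g j)) ->
  exists Z : nat -> (T -> F) -> Prop,
    [/\ forall j, (j <= e)%N -> zirreducible (Z j),
        forall j, (j < e)%N ->
          (forall x, Z j x -> Z j.+1 x) /\ (exists x, Z j.+1 x /\ ~ Z j x)
      & forall x, Z e x -> Y x].
Proof.
elim: e g Y => [|e IH] g Y Yc Yd.
  by have [Z [Zi ZY _]] := zirreducible_dense Yc Yd; exists (fun=> Z).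
have [Z [Zi ZY Zd]] := zirreducible_dense Yc Yd.
have Zc : zclosed Z by case: Zi.
have [c sd] := slice_dense Zc Zd.
have [C [Ci Cs CZ]] := IH _ _ (zclosed_slice _ _ Zc) sd.
exists (fun j => if (j <= e)%N then C j else Z); split.
- by move=> j je1; case: ifP => // je; apply: Ci.
- move=> j; rewrite ltnS => je; rewrite je; case: ltnP => je'; first exact: Cs.
  have -> : j = e by apply/eqP; rewrite eqn_leq je.
  split=> [x /CZ[] //|].
  apply: NNPP => nx; apply: Zd.
  exists (fun v => v ord0 - c).
    split; first by apply: polyfun_ext (pf_add (pf_coord F _) (pf_cst _ (- c))) _.
    exists (fun=> c + 1); apply/eqP; rewrite addrAC subrr add0r; exact: oner_neq0.
  move=> x Zx; apply: NNPP => xc; apply: nx; exists x; split=> // /CZ[_ E].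
  by apply: xc; rewrite E subrr.
- by move=> x; rewrite ltnn; apply: ZY.
Qed.

(** Independent coordinates would give a chain of length [d.+1] in the closure of [X]. *)
Lemma zdim_algdep X d (g : 'I_d.+1 -> T) : zdim X d -> algdep X (fun j x => x (g j)).
Proof.
move=> [_ hmax]; apply: NNPP => Xd.
have Xc : zclosed (zclosure X).
  exists (fun p => polyfun p /\ forall y, X y -> p y = 0); split=> [p [] //|x].
  by split=> [h p [pp hp]|h p pp hp]; apply: h.
have XX x : X x -> zclosure X x by move=> Xx p _; apply.
have /hmax : zchain X d.+1.
  by apply: (chain_of_dense (g := g) Xc); move=> /(algdepS XX).
by rewrite ltnn.
Qed.

End Chains.

(** * Hankel matrices *)

Section MonExponents.
Variables (m i : nat).

Definition mon_mnm (e : mon m i) : 'X_{1..m} := [multinom (val e j : nat) | j < m].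

Lemma mdeg_mon (e : mon m i) : (mdeg (mon_mnm e) < i)%N.
Proof.
rewrite mdegE; under eq_bigr do rewrite mnmE; exact: (valP e).
Qed.

Lemma mon_mnm_inj : injective mon_mnm.
Proof.
move=> e f E; apply: val_inj; apply/ffunP => j; apply: val_inj.
by have := congr1 (fun u : 'X_{1..m} => u j) E; rewrite !mnmE.
Qed.

Lemma mon_mnm_surj (u : 'X_{1..m}) : (mdeg u < i)%N -> exists e, mon_mnm e = u.
Proof.
move=> ui.
have uj j : (u j < i)%N.
  by apply: leq_ltn_trans ui; rewrite mdegE (bigD1 j) //= leq_addr.
have H : (\sum_(j < m) ([ffun j => Ordinal (uj j)] j : nat) < i)%N.
  by under eq_bigr do rewrite ffunE; rewrite mdegE in ui.
pose w : {ffun 'I_m -> 'I_i} := [ffun j => Ordinal (uj j)].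
exists (exist (fun f : {ffun 'I_m -> 'I_i} => (\sum_(j < m) f j < i)%N) w H).
by apply/mnmP => j; rewrite mnmE /= ffunE.
Qed.

Lemma mon_mnmD (a b e : mon m i) :
  [forall j, ((val a j : nat) + val b j == val e j)%N] =
  ((mon_mnm a + mon_mnm b)%MM == mon_mnm e).
Proof.
apply/forallP/eqP => [H|H j].
  by apply/mnmP => j; rewrite mnmDE !mnmE; apply/eqP.
by have := congr1 (fun u : 'X_{1..m} => u j) H; rewrite /= mnmDE !mnmE => ->.
Qed.

(** Converts an arbitrary exponent into a sum over the finite type [mon m i]; in degrees at least
    [i] both sides are 0. *)
Lemma sum_mon_mnm (F : fieldType) (psi : 'X_{1..m} -> F) (u : 'X_{1..m}) :
  (forall u, (i <= mdeg u)%N -> psi u = 0) ->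
  \sum_(e : mon m i) (u == mon_mnm e)%:R * psi (mon_mnm e) = psi u.
Proof.
move=> psi0; case: (ltnP (mdeg u) i) => [/mon_mnm_surj[e <-]|ui].
  rewrite (bigD1 e) //= eqxx mul1r big1 ?addr0 // => f.
  by rewrite eq_sym -(inj_eq mon_mnm_inj) => /negPf ->; rewrite mul0r.
rewrite psi0 // big1 // => e _; case: eqP => [E|]; last by rewrite mul0r.
by have := mdeg_mon e; rewrite -E ltnNge ui.
Qed.

End MonExponents.

Lemma exists_mnm_deg m (c : 'X_{1..m}) s : (s <= mdeg c)%N ->
  exists2 u : 'X_{1..m}, (u <= c)%MM & mdeg u = s.
Proof.
elim: s => [|s IH] sc.
  by exists 0%MM; rewrite ?mdeg0 //; apply/mnm_lepP => j; rewrite mnm0E.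
have [u uc us] := IH (ltnW sc).
have [j uj] : exists j, (u j < c j)%N.
  apply/existsP; apply: contraTT sc => /existsPn H.
  by rewrite -leqNgt -us !mdegE; apply: leq_sum => j _; rewrite leqNgt.
exists (u + U_(j))%MM; last by rewrite mdegD mdeg1 us addn1.
apply/mnm_lepP => l; rewrite mnmDE mnm1E; case: eqP => [<-|_].
  by rewrite addn1.
by rewrite addn0; move/mnm_lepP: uc.
Qed.

Section LinearAlgebra.
Variable F : fieldType.

Lemma mxrank_mxsub p q p' q' (f : 'I_p' -> 'I_p) (g : 'I_q' -> 'I_q)
  (A : 'M[F]_(p, q)) : (\rank (mxsub f g A) <= \rank A)%N.
Proof.
have -> : mxsub f g A = rowsub f 1%:M *m A *m colsub g 1%:M.
  by rewrite -rowsubE -[in LHS](mulmx1 A) mxsub_mul.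
exact: leq_trans (mxrankM_maxl _ _) (mxrankM_maxr _ _).
Qed.

(** Multiplying a row basis by the inverse of a maximal invertible minor produces the identity block
    that a chart of the Grassmannian requires. *)
Lemma reduced_row_basis p n c (A : 'M[F]_(p, n)) : \rank A = c ->
  exists (B : 'M[F]_(c, n)) (J : 'I_c -> 'I_n),
    [/\ injective J, colsub J B = 1%:M & (B :=: A)%MS].
Proof.
move=> <-; set A0 := row_base A.
have full : row_full A0^T by rewrite /row_full mxrank_tr eq_row_base.
set J := fullrankfun full.
have U : colsub J A0 \in unitmx.
  by rewrite -unitmx_tr trmx_mxsub; apply: fullrowsub_unit.
exists (invmx (colsub J A0) *m A0), J; split.
- exact: fullrankfun_inj.
- have -> : colsub J (invmx (colsub J A0) *m A0) = invmx (colsub J A0) *m colsub J A0.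
    by apply/matrixP => i j; rewrite !mxE; apply: eq_bigr => l _; rewrite !mxE.
  by rewrite mulVmx.
- apply: (eqmx_trans _ (eq_row_base A)); apply: eqmxMfull.
  by rewrite row_full_unit unitmx_inv.
Qed.
End LinearAlgebra.

Section Hankel.
Variables (F : fieldType) (m : nat) (phi : 'X_{1..m} -> F).

Definition hankel i : 'M[F]_#|{: mon m i}| :=
  \matrix_(s, t) phi (mon_mnm (enum_val s) + mon_mnm (enum_val t))%MM.

(** For divisors u_j of [c] of each degree j from 0 to [mdeg c], the minor with entries phi(c - u_i
    + u_j) is triangular with diagonal [phi c], since [phi] vanishes above the degree of [c]. *)
Lemma hankel_rank_gt k (c : 'X_{1..m}) : phi c != 0 -> (mdeg c < k)%N ->
  (forall e, (mdeg c < mdeg e)%N -> phi e = 0) -> (mdeg c < \rank (hankel k))%N.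
Proof.
move=> c0 ck ctop.
have /fin_all_exists2[u uc us] (j : 'I_(mdeg c).+1) := exists_mnm_deg (ltn_ord j).
have /fin_all_exists[g hg] (j : 'I_(mdeg c).+1) : exists e : mon m k, mon_mnm e = u j.
  by apply: mon_mnm_surj; apply: leq_ltn_trans ck; rewrite us -ltnS.
have /fin_all_exists[f hf] (j : 'I_(mdeg c).+1) : exists e : mon m k, mon_mnm e = (c - u j)%MM.
  by apply: mon_mnm_surj; apply: leq_ltn_trans (mdegB _ _) ck.
pose S := mxsub (fun j => enum_rank (f j)) (fun j => enum_rank (g j)) (hankel k).
have SE i j : S i j = phi (c - u i + u j)%MM.
  by rewrite !mxE !enum_rankK hf hg.
have St : is_trig_mx S.
  apply/is_trig_mxP => i j ij; rewrite SE ctop // mdegD us.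
  have E : (mdeg (c - u i)%MM + i = mdeg c)%N by rewrite -[X in (_ + X)%N](us i) -mdegD submK.
  by rewrite -[X in (X < _)%N]E ltn_add2l.
have SU : S \in unitmx.
  by rewrite unitmxE det_trig // unitfE; apply/prodf_neq0 => i _; rewrite SE submK.
by have := mxrank_mxsub (fun j => enum_rank (f j)) (fun j => enum_rank (g j)) (hankel k);
  rewrite -/S mxrank_unit.
Qed.

(** Applied to an exponent of top degree in the support of [phi], [hankel_rank_gt] bounds that
    degree by the rank. *)
Lemma hankel_vanish k : (forall e, (k <= mdeg e)%N -> phi e = 0) ->
  forall e, (\rank (hankel k) <= mdeg e)%N -> phi e = 0.
Proof.
move=> phik e re; apply/eqP; apply: contraT => phie.
have [c [c0 rc ctop]] : exists c, [/\ phi c != 0, (\rank (hankel k) <= mdeg c)%N &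
    forall e, (mdeg c < mdeg e)%N -> phi e = 0].
  apply: NNPP => nex.
  have H n : exists2 c, phi c != 0 & (\rank (hankel k) + n <= mdeg c)%N.
    elim: n => [|n [c c0 rc]]; first by exists e; rewrite ?addn0.
    apply: NNPP => nc; apply: nex; exists c; split=> // [|e' ce'].
      by apply: leq_trans rc; apply: leq_addr.
    apply/eqP; apply: contraT => e'0; case: nc; exists e' => //.
    by rewrite addnS; apply: leq_ltn_trans rc ce'.
  have [c /eqP c0 rc] := H k; case: c0; apply: phik.
  by apply: leq_trans rc; apply: leq_addl.
have ck : (mdeg c < k)%N by rewrite ltnNge; apply: contra c0 => /phik ->.
by have := hankel_rank_gt c0 ck ctop; rewrite ltnNge rc.
Qed.

(** The smaller matrix is a submatrix of the larger one, which in turn is P H P^T for the smaller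
    [H] and a 0-1 matrix [P], as its other entries vanish. *)
Lemma hankel_rank_eq k r : (r <= k)%N -> (forall e, (r <= mdeg e)%N -> phi e = 0) ->
  \rank (hankel r) = \rank (hankel k).
Proof.
move=> rk phir; apply/eqP; rewrite eqn_leq; apply/andP; split.
  have /fin_all_exists[f hf] (e : mon m r) : exists e' : mon m k, mon_mnm e' = mon_mnm e.
    by apply: mon_mnm_surj; apply: leq_trans (mdeg_mon e) rk.
  have -> : hankel r = mxsub (fun s => enum_rank (f (enum_val s)))
      (fun s => enum_rank (f (enum_val s))) (hankel k).
    by apply/matrixP => s t; rewrite !mxE !enum_rankK !hf.
  exact: mxrank_mxsub.
pose P : 'M[F]_(#|{: mon m k}|, #|{: mon m r}|) :=
  \matrix_(s, t) (mon_mnm (enum_val s) == mon_mnm (enum_val t))%:R.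
have sumP (s : 'I_#|{: mon m k}|) (psi : 'X_{1..m} -> F) :
    (forall e, (r <= mdeg e)%N -> psi e = 0) ->
    \sum_t P s t * psi (mon_mnm (enum_val t)) = psi (mon_mnm (enum_val s)).
  move=> psi0; rewrite -[RHS](sum_mon_mnm _ psi0).
  rewrite (reindex enum_rank) /=; last by apply: onW_bij; apply: enum_rank_bij.
  by apply: eq_bigr => t _; rewrite mxE enum_rankK.
have -> : hankel k = P *m hankel r *m P^T.
  apply/matrixP => s t; rewrite [LHS]mxE [RHS]mxE.
  rewrite -[LHS](sumP t (fun u => phi (mon_mnm (enum_val s) + u)%MM)); last first.
    by move=> u ru; rewrite phir // mdegD; apply: leq_trans ru (leq_addl _ _).
  apply: eq_bigr => j _; rewrite mulrC [P^T _ _]mxE; congr (_ * _).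
  rewrite [RHS]mxE -(sumP s (fun u => phi (u + mon_mnm (enum_val j))%MM)).
    by apply: eq_bigr => l _; rewrite [hankel _ _ _]mxE.
  by move=> u ru; rewrite phir // mdegD; apply: leq_trans ru (leq_addr _ _).
exact: leq_trans (mxrankM_maxl _ _) (mxrankM_maxr _ _).
Qed.

End Hankel.

(** * Gorenstein ideals as annihilators *)

Section InverseSystem.
Variables (F : fieldType) (m r : nat) (phi : 'X_{1..m} -> F).
Hypothesis phi_r : forall e, (r <= mdeg e)%N -> phi e = 0.
Implicit Types (v w : tpoly F m r) (b : 'X_{1..m}).

(* [pairing v b] is [phi (v * x^b)], so that [annihilator] is the ideal of all
   [v] with [phi (v * g) = 0] for every [g]. *)
Definition pairing v b := \sum_e v e * phi (mon_mnm e + b)%MM.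

Definition annihilator v : Prop := forall b, pairing v b = 0.

Lemma pairing_tmul (g v : tpoly F m r) b :
  pairing (tmul g v) b = \sum_a g a * pairing v (mon_mnm a + b)%MM.
Proof.
have phi0 b' u : (r <= mdeg u)%N -> phi (u + b')%MM = 0.
  by move=> ru; rewrite phi_r // mdegD; apply: leq_trans ru (leq_addr _ _).
rewrite /pairing /tmul; under eq_bigr do rewrite big_distrl /=.
rewrite exchange_big /=; apply: eq_bigr => a _.
under eq_bigr do rewrite big_distrl /=.
rewrite exchange_big /= big_distrr /=; apply: eq_bigr => c _.
transitivity (g a * v c * phi (mon_mnm a + mon_mnm c + b)%MM); last first.
  by rewrite mulrA addmA [(mon_mnm c + _)%MM]addmC.
rewrite -(sum_mon_mnm _ (phi0 b)) big_distrr /=; apply: eq_bigr => e _.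
rewrite mon_mnmD; case: eqP => _; first by rewrite mul1r.
by rewrite !mul0r ?mulr0.
Qed.

Lemma pairingD v w b : pairing (fun e => v e + w e) b = pairing v b + pairing w b.
Proof. by rewrite /pairing -big_split; apply: eq_bigr => e _; rewrite mulrDl. Qed.

Lemma pairingZ a v b : pairing (fun e => a * v e) b = a * pairing v b.
Proof. by rewrite /pairing big_distrr; apply: eq_bigr => e _; rewrite /= mulrA. Qed.

Lemma annihilator_ideal : tideal annihilator.
Proof.
split=> [b|v w hv hw b|g v hv b].
- by rewrite /pairing big1 // => e _; rewrite mul0r.
- by rewrite pairingD hv hw addr0.
- by rewrite pairing_tmul big1 // => a _; rewrite hv mulr0.
Qed.

(** Modulo the annihilator [J] is the line spanned by [v], so each variable acts on it by a scalar;
    the action is nilpotent because [phi] kills high degrees, and the scalar is 0. Thus [v]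
    represents a socle element. *)
Lemma socle_pairing J v : (1 < r)%N -> tideal J -> ~ annihilator v ->
  (forall u, J u <-> exists w a, annihilator w /\ u = (fun e => w e + a * v e)) ->
  forall b, b <> 0%MM -> pairing v b = 0.
Proof.
move=> r1 [_ _ JM] nv JE.
have Jv : J v.
  apply/JE; exists (fun=> 0), 1; split; first by case: annihilator_ideal.
  by apply: functional_extensionality => e; rewrite add0r mul1r.
have [b0 vb0] : exists b, pairing v b <> 0 by apply: not_all_ex_not.
have vU j b : pairing v (U_(j) + b)%MM = 0.
  pose xj : tpoly F m r := fun a => (U_(j)%MM == mon_mnm a)%:R.
  have [w [s [hw E]]] := (JE _).1 (JM xj v Jv).
  have vs b' : pairing v (U_(j) + b')%MM = s * pairing v b'.
    transitivity (pairing (tmul xj v) b').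
      have p0 u : (r <= mdeg u)%N -> pairing v (u + b')%MM = 0.
        move=> ru; rewrite /pairing big1 // => e _; rewrite phi_r ?mulr0 // !mdegD.
        by apply: leq_trans ru _; rewrite addnCA leq_addr.
      by rewrite pairing_tmul -(sum_mon_mnm _ p0).
    by rewrite E pairingD pairingZ hw add0r.
  rewrite vs; suff -> : s = 0 by rewrite mul0r.
  have vsn n : pairing v (U_(j) *+ n + b0)%MM = s ^+ n * pairing v b0.
    elim: n => [|n IH]; first by rewrite mulm0n add0m mul1r.
    by rewrite mulmS -addmA vs IH exprS mulrA.
  have /eqP : s ^+ r * pairing v b0 = 0.
    rewrite -vsn /pairing big1 // => e _; rewrite phi_r ?mulr0 // !mdegD mdegMn mdeg1.
    by rewrite mul1n addnCA leq_addr.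
  by rewrite mulf_eq0 expf_eq0 => /orP[/andP[_ /eqP]|/eqP].
move=> b /eqP; rewrite -mdeg_eq0 mdegE sum_nat_eq0 => /forallPn[j].
rewrite /= -lep1mP => /submK <-; by rewrite addmC vU.
Qed.

(** A socle element is determined modulo the annihilator by its pairing with 1, so the socle is at
    most a line and there is at most one ideal [J]. *)
Lemma annihilator_gorenstein : (1 < r)%N -> gorenstein annihilator.
Proof.
move=> r1.
have [[J0 hJ0]|n] := classic (exists J, colength_one_less annihilator J); last first.
  by exists nil => J hJ; case: n; exists J.
exists [:: J0] => J hJ; left.
have sub J1 J2 : colength_one_less annihilator J1 -> colength_one_less annihilator J2 ->
    forall u, J1 u -> J2 u.
  move=> [I1 [v1 [n1 E1]]] [I2 [v2 [n2 E2]]] u /E1[w [a [hw ->]]].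
  have s1 := socle_pairing r1 I1 n1 E1; have s2 := socle_pairing r1 I2 n2 E2.
  have v20 : pairing v2 0%MM <> 0.
    by move=> v0; apply: n2 => b; have [->|/eqP/s2] := eqVneq b 0%MM.
  (* With this ratio [v1 - s v2] pairs to 0 with 1 as well as with all other monomials. *)
  pose s := pairing v1 0%MM / pairing v2 0%MM.
  apply/E2; exists (fun e => w e + a * (v1 e + (- s) * v2 e)), (a * s); split.
    move=> b; rewrite pairingD pairingZ pairingD pairingZ hw add0r.
    have [->|/eqP b0] := eqVneq b 0%MM; last by rewrite s1 // s2 // mulr0 addr0 mulr0.
    by rewrite /s mulNr divfK ?subrr ?mulr0 //; apply/eqP.
  apply: functional_extensionality => e.
  by rewrite mulrDr mulNr mulrN mulrA addrA subrK.
apply: functional_extensionality => u; apply: propositional_extensionality.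
by split; apply: sub.
Qed.

(** Identifies the annihilator with the left kernel of the Hankel matrix, so that its codimension is
    the Hankel rank. *)
Lemma annihilator_row v :
  annihilator v <-> (\row_s v (enum_val s) : 'rV[F]__) *m hankel phi r = 0.
Proof.
have E s : ((\row_s v (enum_val s) : 'rV[F]__) *m hankel phi r) 0 s =
    pairing v (mon_mnm (enum_val s)).
  rewrite mxE /pairing (reindex enum_rank) /=; last by apply: onW_bij; apply: enum_rank_bij.
  by apply: eq_bigr => e _; rewrite !mxE enum_rankK.
split=> [h|h b]; first by apply/rowP => s; rewrite E h mxE.
case: (ltnP (mdeg b) r) => [/mon_mnm_surj[e <-]|rb].
  by have := E (enum_rank e); rewrite h mxE enum_rankK.
rewrite /pairing big1 // => e _; rewrite phi_r ?mulr0 // mdegD.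
by apply: leq_trans rb (leq_addl _ _).
Qed.

Lemma annihilator_rowspan : \rank (hankel phi r) = r ->
  exists x : 'I_(cdim m r) * mon m r -> F,
    (exists J : 'I_(cdim m r) -> mon m r, injective J /\
       (forall s t, x (s, J t) = if s == t then 1 else 0)) /\
    rowspan x = annihilator.
Proof.
move=> rk; have rker : \rank (kermx (hankel phi r)) = cdim m r.
  by rewrite mxrank_ker rk.
have [B [J [Ji JB BE]]] := reduced_row_basis rker.
pose x (p : 'I_(cdim m r) * mon m r) := B p.1 (enum_rank p.2).
exists x; split.
  exists (fun s => enum_val (J s)); split; first by move=> s t /enum_val_inj/Ji.
  move=> s t; rewrite /x /= enum_valK.
  by have := congr1 (fun M : 'M_ _ => M s t) JB; rewrite !mxE => ->; case: eqP.
apply: functional_extensionality => v; apply: propositional_extensionality.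
have -> : annihilator v <-> ((\row_s v (enum_val s) : 'rV[F]__) <= B)%MS.
  rewrite annihilator_row BE; split=> [h|/sub_kermxP //]; exact/sub_kermxP.
split=> [[a ->]|/submxP[a E]].
  apply/submxP; exists (\row_s a s); apply/rowP => s; rewrite !mxE.
  by apply: eq_bigr => t _; rewrite /x mxE /= enum_valK.
exists (fun s => a 0 s); apply: functional_extensionality => e.
by have := congr1 (fun M : 'rV_ _ => M 0 (enum_rank e)) E; rewrite !mxE enum_rankK.
Qed.

End InverseSystem.

(** The point [x] is the reduced basis of the annihilator of [phi], truncated at degree [r]; pairing
    its rows with 1 shows that [phi] kills them. *)
Lemma hankel_gor_locus (F : fieldType) m k (phi : 'X_{1..m} -> F) :
  let r := \rank (hankel phi k) in
  (forall e, (k <= mdeg e)%N -> phi e = 0) -> (1 < r)%N -> (r <= k)%N ->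
  exists x, gor_locus_charts x /\
    forall s, \sum_e x (s, e) * phi (@mon_mnm m r e) = 0.
Proof.
move=> r phik r1 rk.
have phir : forall e, (r <= mdeg e)%N -> phi e = 0 by apply: hankel_vanish.
have rr : \rank (hankel phi r) = r by apply: hankel_rank_eq.
have [x [xJ xE]] := annihilator_rowspan phir rr.
exists x; split.
  split=> //; rewrite xE; first exact: annihilator_ideal.
  exact: annihilator_gorenstein.
move=> s; have : rowspan x (fun e => x (s, e)).
  exists (fun t => (t == s)%:R); apply: functional_extensionality => e.
  rewrite (bigD1 s) //= eqxx mul1r big1 ?addr0 // => t /negPf ->.
  by rewrite mul0r.
rewrite xE => /(_ 0%MM); rewrite /pairing => {2}<-.
by apply: eq_bigr => e _; rewrite addm0.
Qed.

(** * Generic linear forms *)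

Definition zgeneric (F : fieldType) (I : Type) (Q : (I -> F) -> Prop) : Prop :=
  exists2 p : (I -> F) -> F, polyfun p /\ (exists v, p v <> 0) &
    forall v, p v <> 0 -> Q v.

Section Generic.
Variables (F : numFieldType) (I : Type).
Implicit Types Q : (I -> F) -> Prop.

Lemma zgenericT Q : (forall v, Q v) -> zgeneric Q.
Proof.
move=> QT; exists (fun=> 1) => //; split; first exact: pf_cst.
by exists (fun=> 0); apply/eqP; apply: oner_neq0.
Qed.

Lemma zgeneric_and Q1 Q2 : zgeneric Q1 -> zgeneric Q2 ->
  zgeneric (fun v => Q1 v /\ Q2 v).
Proof.
move=> [p [pp np] hp] [q [pq nq] hq]; exists (fun v => p v * q v).
  split; first exact: pf_mul.
  have [v [/eqP v1 /eqP v2]] := polyfun_mul_neq0 pp pq np nq.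
  by exists v; apply/eqP; rewrite mulf_neq0.
move=> v /eqP; rewrite mulf_eq0 => /norP[/eqP/hp ? /eqP/hq ?]; by split.
Qed.

Lemma zgeneric_forall (J : finType) (Q : J -> (I -> F) -> Prop) :
  (forall j, zgeneric (Q j)) -> zgeneric (fun v => forall j, Q j v).
Proof.
move=> QJ; suff [p np hp] : zgeneric (fun v => forall j, j \in enum J -> Q j v).
  by exists p => // v /hp h j; apply: h; rewrite mem_enum.
elim: (enum J) => [|j s IH]; first exact: zgenericT.
have [p np hp] := zgeneric_and (QJ j) IH; exists p => // v /hp[h1 h2] l.
by rewrite inE => /predU1P[->|/h2].
Qed.

End Generic.

Lemma algdep_subfamily (F : numFieldType) (T : Type) (I I' : finType)
    (X : (T -> F) -> Prop) (f : I -> (T -> F) -> F) (h : I' -> I) : injective h ->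
  algdep X (fun j x => f (h j) x) -> algdep X f.
Proof.
move=> hi [P [pP [u Pu]] hP]; exists (fun v => P (fun j => v (h j))) => //.
split; first by apply: polyfun_comp pP _ => j; apply: pf_coord.
exists (fun i => if [pick j | h j == i] is Some j then u j else 0).
set w := (fun j => _); have -> // : w = u.
apply: functional_extensionality => j; rewrite /w.
by case: pickP => [j' /eqP/hi -> //|/(_ j)]; rewrite eqxx.
Qed.

(** At most #|R| of the chosen coordinates are free ones, so more than [d] come from [X] and are
    dependent: the product of [X] with an affine space of dimension #|R| has dimension at most d +
    #|R|. *)
Lemma algdep_left_sum (F : numClosedFieldType) (A R I : finType) (d : nat)
    (X : (A -> F) -> Prop) (g : I -> A + R) : zdim X d -> injective g ->
  (d < #|I| - #|R|)%N ->
  algdep (fun y : A + R -> F => X (fun a => y (inl a))) (fun j y => y (g j)).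
Proof.
move=> Xd gi dI.
pose B := [pred j | if g j is inl _ then true else false].
have BR : (#|[predC B]| <= #|R|)%N.
  rewrite -(card_image gi) -(card_codom (@inr_inj A R)).
  apply: subset_leq_card; apply/subsetP => t /imageP[j + ->].
  by rewrite !inE; case: (g j) => // b _; apply: codom_f.
have dB : (d < #|B|)%N.
  by apply: leq_trans dI _; rewrite leq_subLR -(cardC B) addnC leq_add2r.
pose h (j : 'I_d.+1) : I := enum_val (widen_ord dB j).
have hi : injective h by move=> j l /enum_val_inj/(congr1 val)/= /val_inj.
have /fin_all_exists[a ha] (j : 'I_d.+1) : exists a, g (h j) = inl a.
  by have := enum_valP (widen_ord dB j); rewrite -/(h j) inE; case: (g _) => // a _; exists a.
apply: (algdep_subfamily hi).
have [P nP hP] := zdim_algdep a Xd; exists P => // y Xy.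
rewrite -[RHS](hP _ Xy); congr P; apply: functional_extensionality => j.
by rewrite ha.
Qed.

(** * The incidence variety of Gorenstein schemes, functionals and linear forms *)

Section Incidence.
Variables (F : numClosedFieldType) (m k N i : nat).
Variables (J : 'I_(cdim m i) -> mon m i) (e0 : mon m i).
Hypotheses (ik : (i <= k)%N) (J_inj : injective J) (e0J : e0 \notin codom J).

Let TS : finType := {e : mon m i | (e \notin codom J) && (e != e0)}.
Let TL : finType := {le : 'I_N * mon m k | mon_mnm le.2 != mon_mnm e0}.
Let T : finType := ('I_(cdim m i) * mon m i + (TS + TL))%type.

Let card_TS : (#|TS| < i)%N.
Proof.
have E : (#|[pred e | e \notin codom J]| <= i)%N.
  have := cardC (mem (codom J)); rewrite (card_codom J_inj) card_ord -/(nmon m i) => E.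
  rewrite -(leq_add2l (cdim m i)) (eq_card (_ : _ =i [predC codom J])) // E.
  by rewrite addnC -leq_subLR.
apply: leq_trans E; rewrite card_sig (cardD1 e0 [pred e | e \notin codom J]) inE e0J add1n ltnS.
by apply: subset_leq_card; apply/subsetP => e; rewrite !inE andbC.
Qed.

Let card_TL : (#|TL| + N <= #|{: 'I_N * mon m k}|)%N.
Proof.
have [e ee0] : exists e : mon m k, mon_mnm e = mon_mnm e0.
  by apply: mon_mnm_surj; apply: leq_trans (mdeg_mon e0) ik.
rewrite card_sig -(cardC [pred le : 'I_N * mon m k | mon_mnm le.2 != mon_mnm e0]) leq_add2l.
have inj : injective (fun l : 'I_N => (l, e)) by move=> l l' [].
rewrite -{1}(card_ord N) -(card_codom inj); apply: subset_leq_card.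
by apply/subsetP => le /codomP[l ->]; rewrite !inE negbK /= ee0.
Qed.

(** These functions recover [phi] and [L] from the parameters. [sv] gives [phi] off the pivots, the
    default 1 being its value at [e0]; [pv] solves the row equations of [x] for the values at the
    pivots; [pk] extends by 0. [lv] solves L(phi) = 0 for the coefficient at [e0], using phi(e0) =
    1. *)
Let sv (e : mon m i) (y : T -> F) : F :=
  if insub e is Some t then y (inr (inl t)) else 1.
Let pv (e : mon m i) (y : T -> F) : F :=
  if [pick t | J t == e] is Some t
  then - \sum_(e' | e' \notin codom J) y (inl (t, e')) * sv e' y else sv e y.
Let pk (u : 'X_{1..m}) (y : T -> F) : F := \sum_e (u == mon_mnm e)%:R * pv e y.
Let lw (le : 'I_N * mon m k) (y : T -> F) : F :=
  if insub le is Some t then y (inr (inr t)) else 0.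
Let lv (le : 'I_N * mon m k) (y : T -> F) : F :=
  if mon_mnm le.2 == mon_mnm e0
  then - \sum_(e | mon_mnm e != mon_mnm e0) lw (le.1, e) y * pk (mon_mnm e) y
  else lw le y.

Let polyfun_lv le : polyfun (lv le).
Proof.
have psv e : polyfun (sv e).
  by rewrite /sv; case: insub => [t|]; [apply: pf_coord | apply: pf_cst].
have ppv e : polyfun (pv e).
  rewrite /pv; case: pickP => // t _; apply: polyfun_opp; apply: polyfun_sum => e' _.
  by apply: pf_mul => //; apply: pf_coord.
have ppk u : polyfun (pk u).
  by apply: polyfun_sum => e _; apply: pf_mul => //; apply: pf_cst.
have plw le' : polyfun (lw le').
  by rewrite /lw; case: insub => [t|]; [apply: pf_coord | apply: pf_cst].
rewrite /lv; case: (mon_mnm le.2 == mon_mnm e0) => //; apply: polyfun_opp; apply: polyfun_sum => e _.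
exact: pf_mul.
Qed.

(* The pairs [(x, L)] killed by a functional [phi] with [phi e0 = 1] are
   parametrised by [x], the values of [phi] off the pivots [J] and off [e0],
   and the coefficients of [L] off [e0]. *)
Lemma generic_no_kernel d : zdim (@gor_locus_charts F m i) d -> (d + i <= N)%N ->
  zgeneric (fun L : 'I_N * mon m k -> F => forall x (phi : 'X_{1..m} -> F),
    gor_locus_charts x ->
    (forall s t, x (s, J t) = if s == t then 1 else 0) ->
    (forall e, (i <= mdeg e)%N -> phi e = 0) -> phi (mon_mnm e0) = 1 ->
    (forall s, \sum_e x (s, e) * phi (mon_mnm e) = 0) ->
    exists l, \sum_e L (l, e) * phi (mon_mnm e) <> 0).
Proof.
move=> Xd dN.
pose Y (y : T -> F) := gor_locus_charts (fun p => y (inl p)).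
(* The parameters have dimension at most d + #|TS| + #|TL|. As #|TS| < i, d + i <= N and [TL] omits
   [N] coefficients, this is less than the number of coefficients of [L]; hence these satisfy a
   relation [P], and [L] with [P L] nonzero is good. *)
have [||P nP hP] := @algdep_of_coords_fin F T ('I_N * mon m k)%type Y _ lv polyfun_lv.
- move=> g gi; apply: algdep_left_sum gi _; first exact: Xd.
  have TSd : (#|TS| + d < N)%N.
    by apply: leq_trans dN; rewrite addnC -addnS leq_add2l.
  rewrite ltn_subRL card_sum; apply: leq_trans card_TL.
  by rewrite [(#|TS| + _)%N]addnC -addnA -addnS leq_add2l.
- apply/card_gt0P.
  have [e ee0] : exists e : mon m k, mon_mnm e = mon_mnm e0.
    by apply: mon_mnm_surj; apply: leq_trans (mdeg_mon e0) ik.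
  have N0 : (0 < N)%N.
    by apply: leq_trans dN; rewrite addn_gt0 (leq_ltn_trans _ card_TS) ?orbT.
  by exists (Ordinal N0, e).
exists P => // L PL x phi Xx xJ phi_i phi1 xphi; apply: NNPP => nl; apply: PL.
have {}nl l : \sum_e L (l, e) * phi (mon_mnm e) = 0.
  by apply: NNPP => h; apply: nl; exists l.
pose y (t : T) : F := match t with
  | inl p => x p | inr (inl t) => phi (mon_mnm (val t)) | inr (inr t) => L (val t) end.
have svE e : e \notin codom J -> sv e y = phi (mon_mnm e).
  move=> eJ; rewrite /sv; case: insubP => [t _ <- //|].
  by rewrite eJ negbK => /eqP ->.
have pvE e : pv e y = phi (mon_mnm e).
  rewrite /pv; case: pickP => [t /eqP <-|nJ]; last first.
    by apply: svE; apply/codomP => -[t E]; have := nJ t; rewrite E eqxx.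
  apply/eqP; rewrite eq_sym -addr_eq0; apply/eqP; rewrite -[RHS](xphi t).
  rewrite [RHS](bigID (mem (codom J))) /=; congr (_ + _).
    rewrite (bigD1 (J t)) ?codom_f //= xJ eqxx mul1r big1 ?addr0 //.
    move=> _ /andP[/codomP[t' ->]]; rewrite (inj_eq J_inj) eq_sym xJ => /negPf ->.
    by rewrite mul0r.
  by apply: eq_bigr => e' /svE ->.
have pkE u : pk u y = phi u.
  rewrite -(sum_mon_mnm u phi_i); apply: eq_bigr => e' _; by rewrite pvE.
have lwE le : mon_mnm le.2 != mon_mnm e0 -> lw le y = L le.
  by move=> h; rewrite /lw insubT.
have <- : (fun le => lv le y) = L.
  apply: functional_extensionality => -[l e]; rewrite /lv /=.
  case: eqP => [E|/eqP ne]; last exact: lwE.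
  apply/eqP; rewrite eq_sym -addr_eq0; apply/eqP; rewrite -[RHS](nl l).
  rewrite [RHS](bigD1 e) //= E phi1 mulr1; congr (_ + _).
  apply: eq_big => [e'|e' ne]; first by rewrite -E (inj_eq (@mon_mnm_inj _ _)).
  by rewrite lwE // pkE.
by apply: hP.
Qed.

End Incidence.

(** Finitely many generic conditions, one for each rank [i], pivot set [J] and normalising exponent
    [e0], are imposed together, and a natural point satisfying them all is taken. *)
Lemma exists_generic_forms (F : numClosedFieldType) (m k N : nat) (d : nat -> nat) :
  (0 < k)%N -> (0 < N)%N ->
  (forall i, (2 <= i <= k)%N -> zdim (@gor_locus_charts F m i) (d i)) ->
  (forall i, (2 <= i <= k)%N -> (d i + i <= N)%N) ->
  exists a : 'I_N * mon m k -> nat, forall phi : 'X_{1..m} -> F,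
    (forall e, (k <= mdeg e)%N -> phi e = 0) -> (exists e, phi e <> 0) ->
    (\rank (hankel phi k) <= k)%N ->
    exists l, \sum_e (a (l, e))%:R * phi (mon_mnm e) <> 0.
Proof.
move=> k0 N0 hd hN.
have [z z0] : exists z : mon m k, mon_mnm z = 0%MM by apply: mon_mnm_surj; rewrite mdeg0.
(* Hankel rank at most 1 leaves only multiples of evaluation at 0; a form with nonzero constant term
   detects these. *)
have G0 : zgeneric (fun L : 'I_N * mon m k -> F => L (Ordinal N0, z) <> 0).
  exists (fun L => L (Ordinal N0, z)) => //; split; first exact: pf_coord.
  by exists (fun=> 1); apply/eqP; apply: oner_neq0.
have G1 : zgeneric (fun L : 'I_N * mon m k -> F =>
    forall (i : 'I_k.+1) (J : {ffun 'I_(cdim m i) -> mon m i}) (e0 : mon m i),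
    (1 < i)%N -> injective J -> e0 \notin codom J -> forall x (phi : 'X_{1..m} -> F),
    gor_locus_charts x ->
    (forall s t, x (s, J t) = if s == t then 1 else 0) ->
    (forall e, (i <= mdeg e)%N -> phi e = 0) -> phi (mon_mnm e0) = 1 ->
    (forall s, \sum_e x (s, e) * phi (mon_mnm e) = 0) ->
    exists l, \sum_e L (l, e) * phi (mon_mnm e) <> 0).
  apply: zgeneric_forall => i; apply: zgeneric_forall => J.
  apply: zgeneric_forall => e0.
  have [[i1 Ji e0J]|n] := classic [/\ (1 < i)%N, injective J & e0 \notin codom J];
    last by apply: zgenericT => L h1 h2 h3; case: n.
  have ik : (1 < i <= k)%N by rewrite i1 -ltnS ltn_ord.
  have [p np hp] := generic_no_kernel (proj2 (andP ik)) Ji e0J (hd i ik) (hN i ik).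
  by exists p => // L /hp h _ _ _; apply: h.
have [p [pp np] hp] := zgeneric_and G0 G1.
have [a pa] := polyfun_natpoint pp np.
have [a0 aG] := hp _ pa.
exists a => phi phik [e phie] rk.
have phir := hankel_vanish phik.
set r := \rank (hankel phi k) in rk phir.
have [r1|r1] := leqP r 1.
  have {}phir u : (0 < mdeg u)%N -> phi u = 0 by move=> u0; apply: phir; apply: leq_trans u0.
  have e0 : e = 0%MM.
    by apply/eqP; rewrite -mdeg_eq0 -leqn0 leqNgt; apply/negP => /phir/phie.
  exists (Ordinal N0); rewrite (bigD1 z) //= z0 big1 => [|f fz].
    by rewrite addr0; apply/eqP; rewrite mulf_neq0 //; apply/eqP; rewrite -?e0.
  rewrite phir ?mulr0 // lt0n mdeg_eq0 -z0; apply: contraNneq fz.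
  by move/mon_mnm_inj ->.
have [x [Xx xphi]] := hankel_gor_locus phik r1 rk.
have [[J [Ji xJ]] _ _] := Xx.
(* If [phi] vanished off the pivots, the row equations would make it vanish at the pivots too. *)
have [e0 e0J phie0] : exists2 e0 : mon m r, e0 \notin codom J & phi (mon_mnm e0) != 0.
  apply: NNPP => nex.
  have phiJ0 e' : e' \notin codom J -> phi (@mon_mnm m r e') = 0.
    by move=> e'J; apply/eqP; apply: contraT => h; case: nex; exists e'.
  apply: phie; case: (ltnP (mdeg e) r) => [/mon_mnm_surj[e' <-]|/phir //].
  case e'J: (e' \in codom J); last by rewrite phiJ0 ?e'J.
  have /codomP[t ->] := e'J.
  rewrite -[RHS](xphi t) (bigD1 (J t)) //= xJ eqxx mul1r big1 ?addr0 // => f ft.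
  case fJ: (f \in codom J); last by rewrite phiJ0 ?mulr0 ?fJ.
  move: ft; have /codomP[t' ->] := fJ; rewrite (inj_eq Ji) eq_sym xJ => /negPf ->.
  by rewrite mul0r.
have ri : (r < k.+1)%N by [].
have fJ : (fun t => finfun J t) = J by apply: functional_extensionality => t; rewrite ffunE.
have [||||||||l hl] := aG (Ordinal ri) (finfun J) e0 _ _ _ x
    (fun u => (phi (mon_mnm e0))^-1 * phi u) => //.
- by move=> s t; rewrite !ffunE => /Ji.
- by apply: contra e0J => /codomP[t ->]; rewrite ffunE codom_f.
- by move=> s t; rewrite ffunE xJ.
- by move=> u ru; rewrite (phir u ru) mulr0.
- by rewrite mulVf.
- move=> s; transitivity ((phi (mon_mnm e0))^-1 * \sum_e x (s, e) * phi (mon_mnm e)).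
    rewrite big_distrr /=; apply: eq_bigr => f _; exact: mulrCA.
  by rewrite xphi mulr0.
exists l => h; apply: hl.
transitivity ((phi (mon_mnm e0))^-1 * \sum_e (a (l, e))%:R * phi (mon_mnm e)).
  by rewrite big_distrr /=; apply: eq_bigr => f _; exact: mulrCA.
by rewrite h mulr0.
Qed.

(** * Compactness *)

Lemma bolzano_weierstrass_R (u : nat -> RR) : (forall n, `|u n| <= 1) ->
  exists l : RR, forall (eps : RR) (M : nat), 0 < eps ->
    exists2 n, (M <= n)%N & `|u n - l| < eps.
Proof.
move=> ub; have [|l hl] := Rtopology.Bolzano_Weierstrass u _ (Rtopology.compact_P3 (-1) 1).
  by move=> n; have := ub n; rewrite ler_norml => /andP[a b]; split; apply/RleP.
exists l => eps M /RltP eps0.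
have nb : Rtopology.neighbourhood (Rtopology.disc l (RIneq.mkposreal eps eps0)) l.
  by exists (RIneq.mkposreal eps eps0) => y.
have [n [Mn hn]] := hl _ M nb; exists n; first exact/ssrnat.leP.
exact/RltP.
Qed.

Lemma functional_choice (A B : Type) (R : A -> B -> Prop) :
  (forall x, exists y, R x y) -> exists f, forall x, R x (f x).
Proof.
move=> H; exists (fun x => sval (constructive_indefinite_description _ (H x))) => x.
by case: (constructive_indefinite_description _ _).
Qed.

Lemma bolzano_weierstrass_fin (T : finType) (u : nat -> T -> RR) :
  (forall n t, `|u n t| <= 1) ->
  exists l : T -> RR, forall (eps : RR) (M : nat), 0 < eps ->
    exists2 n, (M <= n)%N & forall t, `|u n t - l t| < eps.
Proof.
move=> ub.
(* Indices [sg n] are extracted coordinate by coordinate; the bound [n <= sg n] suffices to reach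
   every tail. *)
suff [l [sg [sgn hl]]] : exists l (sg : nat -> nat), (forall n, (n <= sg n)%N) /\
    forall t, t \in enum T -> forall eps : RR, 0 < eps ->
    exists M, forall n, (M <= n)%N -> `|u (sg n) t - l t| < eps.
  exists l => eps M eps0.
  have /fin_all_exists[K hK] (t : T) := hl t (mem_enum T t) eps eps0.
  exists (sg (maxn M (\max_t K t)))%N.
    by apply: leq_trans (sgn _); apply: leq_maxl.
  by move=> t; apply: hK; apply: leq_trans (leq_bigmax t) (leq_maxr _ _).
elim: (enum T) => [|t s [l [sg [sgn hl]]]]; first by exists (fun=> 0), id.
have [a ha] := bolzano_weierstrass_R (fun n => ub (sg n) t).
have /functional_choice[tau htau] (n : nat) : exists p, (n <= p)%N /\ `|u (sg p) t - a| < n.+1%:R^-1.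
  have n0 : 0 < n.+1%:R^-1 :> RR by rewrite invr_gt0 ltr0Sn.
  by have [p np hp] := ha _ n n0; exists p.
exists (fun t' => if t' == t then a else l t'), (sg \o tau); split.
  by move=> n; apply: leq_trans (htau n).1 (sgn _).
move=> t'; rewrite inE; case: eqP => [-> _ eps eps0|_ /= /hl h eps /h[M hM]].
  exists (Num.truncn eps^-1) => n Mn; apply: lt_le_trans (htau n).2 _.
  rewrite -[leRHS]invrK lef_pV2 ?posrE ?ltr0Sn ?invr_gt0 //.
  apply/ltW; apply: lt_le_trans (_ : (Num.truncn eps^-1).+1%:R <= _).
    by apply: truncnS_gt.
  by rewrite ler_nat ltnS.
by exists M => n Mn; apply: hM; apply: leq_trans Mn (htau n).1.
Qed.

Lemma complex_lt_Re (z eps : CC) : 0 < eps -> `|complex.Re z| < complex.Re eps / 2%:R ->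
  `|complex.Im z| < complex.Re eps / 2%:R -> `|z| < eps.
Proof.
case: eps => e e'; rewrite ltcE /= => /andP[/eqP -> e0] hr hi.
rewrite normc_def -[X in _ < X]/(e%:C)%C ltcR.
have sq (x : RR) : `|x| < e / 2%:R -> x ^+ 2 < e ^+ 2 / 2%:R.
  move=> h; apply: (@lt_le_trans _ _ ((e / 2%:R) ^+ 2)).
    by rewrite -(real_normK (num_real x)) ltr_pXn2r ?nnegrE // divr_ge0 // ltW.
  rewrite expr_div_n ler_pM2l ?exprn_gt0 // lef_pV2 ?posrE ?exprn_gt0 ?ltr0n //.
  by rewrite -natrX ler_nat.
rewrite -[X in _ < X](ger0_norm (ltW e0)) -sqrtr_sqr ltr_sqrt ?exprn_gt0 //.
by have := ltrD (sq _ hr) (sq _ hi); rewrite -splitr.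
Qed.

Lemma bolzano_weierstrass_C (T : finType) (u : nat -> T -> CC) :
  (forall n t, `|u n t| <= 1) ->
  exists l : T -> CC, forall (eps : CC) (M : nat), 0 < eps ->
    exists2 n, (M <= n)%N & forall t, `|u n t - l t| < eps.
Proof.
move=> ub.
pose v n (p : bool * T) : RR := if p.1 then complex.Re (u n p.2) else complex.Im (u n p.2).
have [|l hl] := @bolzano_weierstrass_fin (bool * T)%type v.
  move=> n [b t]; rewrite /v /=; have := ub n t; rewrite normc_def lecE /= => /andP[_ h].
  have h2 : complex.Re (u n t) ^+ 2 + complex.Im (u n t) ^+ 2 <= 1.
    by rewrite -ler_sqrt // sqrtr1.
  case: b; rewrite -(ler_pXn2r (n := 2)) ?nnegrE // expr1n (real_normK (num_real _)); apply: le_trans h2.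
    by rewrite lerDl sqr_ge0.
  by rewrite lerDr sqr_ge0.
exists (fun t => (l (true, t) +i* l (false, t))%C) => eps M eps0.
have [|n Mn h] := hl (complex.Re eps / 2%:R) M.
  by move: eps0; rewrite ltcE /= => /andP[_ h]; rewrite divr_gt0.
exists n => // t; apply: complex_lt_Re => //.
  by have := h (true, t); rewrite /v /= raddfB.
by have := h (false, t); rewrite /v /= raddfB.
Qed.

(** * Functionals supported on finitely many points *)

Section Continuity.
Variables (F : numFieldType) (T : Type).

(** The value ab/(a + b) serves as a minimum without comparing [a] and [b]. *)
Lemma exists_lt2 (a b : F) : 0 < a -> 0 < b -> exists c, [/\ 0 < c, c < a & c < b].
Proof.
move=> a0 b0; have ab : 0 < a + b by rewrite addr_gt0.
exists (a * b / (a + b)); split; first by rewrite divr_gt0 ?mulr_gt0.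
  by rewrite ltr_pdivrMr // ltr_pM2l // ltrDr.
by rewrite ltr_pdivrMr // mulrC ltr_pM2l // ltrDl.
Qed.

Definition continuous_at (p : (T -> F) -> F) (x : T -> F) : Prop :=
  forall eps : F, 0 < eps -> exists2 delta : F, 0 < delta &
    forall y, (forall t, `|y t - x t| < delta) -> `|p y - p x| < eps.

Lemma continuous_atM p q x :
  continuous_at p x -> continuous_at q x -> continuous_at (fun y => p y * q y) x.
Proof.
move=> hp hq eps eps0.
pose S := `|p x| + `|q x| + 1.
have S0 : 0 < S by rewrite ltr_wpDl ?addr_ge0.
have S1 : 0 < S + eps by rewrite addr_gt0.
(* This choice gives both e < 1 and e S < eps. *)
pose e := eps / (S + eps).
have e0 : 0 < e by rewrite divr_gt0.
have e1 : e < 1 by rewrite ltr_pdivrMr // mul1r ltrDr.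
have [d1 d10 h1] := hp e e0; have [d2 d20 h2] := hq e e0.
have [d [d0 dd1 dd2]] := exists_lt2 d10 d20.
exists d => // y hy.
have {}h1 : `|p y - p x| < e by apply: h1 => t; apply: lt_trans dd1.
have {}h2 : `|q y - q x| < e by apply: h2 => t; apply: lt_trans dd2.
have -> : p y * q y - p x * q x =
    (p y - p x) * (q y - q x) + (p y - p x) * q x + p x * (q y - q x).
  by rewrite !mulrBl !mulrBr; ring.
apply: (@le_lt_trans _ _ (e * S)); last first.
  by rewrite mulrAC ltr_pdivrMr // ltr_pM2l // ltrDl.
have -> : e * S = e + e * `|q x| + `|p x| * e by rewrite /S; ring.
apply: le_trans (ler_normD _ _) _; apply: lerD; last by rewrite normrM ler_wpM2l // ltW.
apply: le_trans (ler_normD _ _) _; apply: lerD; last by rewrite normrM ler_wpM2r // ltW.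
rewrite normrM -[leRHS]mulr1; apply: ler_pM => //; first exact: ltW.
exact: ltW (lt_trans h2 e1).
Qed.

Lemma polyfun_continuous p x : polyfun p -> continuous_at p x.
Proof.
elim=> [c|t|p1 p2 _ h1 _ h2|p1 p2 _ h1 _ h2].
- by move=> eps eps0; exists 1; rewrite ?ltr01 // => y _; rewrite subrr normr0.
- by move=> eps eps0; exists eps.
- move=> eps eps0; have e0 : 0 < eps / 2%:R by rewrite divr_gt0.
  have [d1 d10 {}h1] := h1 _ e0; have [d2 d20 {}h2] := h2 _ e0.
  have [d [d0 dd1 dd2]] := exists_lt2 d10 d20.
  exists d => // y hy; rewrite opprD addrACA (splitr eps).
  apply: le_lt_trans (ler_normD _ _) _; apply: ltrD.
    by apply: h1 => t; apply: lt_trans dd1.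
  by apply: h2 => t; apply: lt_trans dd2.
- exact: continuous_atM.
Qed.

Lemma lt_eps_eq0 (z : F) : (forall eps, 0 < eps -> `|z| < eps) -> z = 0.
Proof.
move=> h; apply/eqP; rewrite -normr_eq0; apply: contraT => z0.
have zp : 0 < `|z| by rewrite lt_neqAle eq_sym z0 normr_ge0.
by have := h _ zp; rewrite ltxx.
Qed.

Lemma polyfun_cluster (p : (T -> F) -> F) (u : nat -> T -> F) (l : T -> F) :
  polyfun p -> (forall n, p (u n) = 0) ->
  (forall eps : F, 0 < eps -> exists n, forall t, `|u n t - l t| < eps) -> p l = 0.
Proof.
move=> pp pu ul; apply: lt_eps_eq0 => eps eps0.
have [d d0 hd] := polyfun_continuous l pp eps0.
have [n hn] := ul d d0; have := hd _ hn.
by rewrite pu sub0r normrN.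
Qed.

End Continuity.

Section PointFunctional.
Variables (F : numFieldType) (m k : nat).
Variables (x : 'I_k -> 'I_m -> F) (c : 'I_k -> F).

Definition point_functional (P : {mpoly F[m]}) : F := \sum_j c j * P.@[x j].

Lemma point_functionalB P Q :
  point_functional (P - Q) = point_functional P - point_functional Q.
Proof.
rewrite /point_functional -sumrB; apply: eq_bigr => j _.
by rewrite mevalB mulrBr.
Qed.

Lemma point_functionalE P :
  point_functional P = \sum_(e <- msupp P) P@_e * point_functional 'X_[e].
Proof.
rewrite /point_functional; under [RHS]eq_bigr do rewrite big_distrr /=.
rewrite exchange_big /=; apply: eq_bigr => j _.
rewrite {1}(mpolyE P) raddf_sum big_distrr /=; apply: eq_bigr => e _.
by rewrite mevalZ mulrCA.
Qed.

(** A product of k - 1 polynomials of degree at most 1, each vanishing at one other point but not at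
    [x j0], isolates the term of [j0]; so the functional is nonzero on some monomial of that
    product. *)
Lemma point_functional_neq0 : injective x -> (exists j, c j <> 0) ->
  exists2 e : 'X_{1..m}, (mdeg e < k)%N & point_functional 'X_[e] <> 0.
Proof.
move=> xi [j0 cj0].
have /fin_all_exists[q hq] (j : 'I_k) : exists q : {mpoly F[m]}, j != j0 ->
    [/\ (msize q <= 2)%N, q.@[x j] = 0 & q.@[x j0] != 0].
  case: (eqVneq j j0) => [->|jj0]; first by exists 0.
  have [a xa] : exists a, x j a != x j0 a.
    apply: NNPP => n; case/eqP: jj0; apply: xi; apply: functional_extensionality => a.
    by apply/eqP; apply: contraT => h; case: n; exists a.
  exists ('X_a - (x j a)%:MP) => _; split.
  - apply: leq_trans (msizeD_le _ _) _; rewrite msizeN msizeC msizeX mdeg1.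
    by rewrite geq_max leqnn /=; case: (_ != _).
  - by rewrite mevalB mevalXU mevalC subrr.
  - by rewrite mevalB mevalXU mevalC subr_eq0 eq_sym.
pose Q := \prod_(j | j != j0) q j.
have Qs : (msize Q <= (k.-1).+1)%N.
  have -> : (k.-1 = \sum_(j < k | j != j0) 1)%N.
    rewrite sum1_card cardC1 card_ord //.
  rewrite /Q; elim/big_rec2: _ => [|j n P jj0 IH]; first by rewrite msize1.
  by apply: msizeM_leq IH; have [] := hq j jj0.
have QE : point_functional Q = c j0 * Q.@[x j0].
  rewrite /point_functional (bigD1 j0) //= big1 ?addr0 // => j jj0.
  rewrite /Q rmorph_prod (bigD1 j) //=.
  by have [_ -> _] := hq j jj0; rewrite mul0r mulr0.
have Q0 : point_functional Q != 0.
  rewrite QE mulf_neq0 //; first exact/eqP.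
  by rewrite /Q rmorph_prod; apply/prodf_neq0 => j /hq[].
apply: NNPP => nex; move: Q0; rewrite point_functionalE big_seq big1 ?eqxx // => e eQ.
have ek : (mdeg e < k)%N.
  have k0 : (0 < k)%N := leq_ltn_trans (leq0n _) (ltn_ord j0).
  by rewrite -(prednK k0); apply: leq_trans (msize_mdeg_lt eQ) Qs.
suff -> : point_functional 'X_[e] = 0 by rewrite mulr0.
by apply: NNPP => h; apply: nex; exists e.
Qed.

(** The Hankel matrix factors through evaluation at the [k] points. *)
Lemma point_hankel_rank i :
  (\rank (hankel (fun e => point_functional 'X_[e]) i) <= k)%N.
Proof.
pose A : 'M[F]_(_, k) := \matrix_(s < #|{: mon m i}|, j < k) 'X_[mon_mnm (enum_val s)].@[x j].
pose B : 'M[F]_(k, _) := \matrix_(j < k, s < #|{: mon m i}|) (c j * 'X_[mon_mnm (enum_val s)].@[x j]).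
have -> : hankel (fun e => point_functional 'X_[e]) i = A *m B.
  apply/matrixP => s t; rewrite !mxE /point_functional; apply: eq_bigr => j _.
  by rewrite !mxE mpolyXD mevalM mulrCA.
exact: leq_trans (mxrankM_maxl _ _) (rank_leq_col _).
Qed.

(* Peel one linear factor [x_a - x_j(a)] off for each point [j] of [js]. *)
Lemma point_functional_near (D : nat) (delta : F) (js : seq 'I_k) (e : 'X_{1..m}) :
  (forall j a, `|x j a| <= delta) ->
  (forall f : 'X_{1..m}, (mdeg f < D)%N -> `|point_functional 'X_[f]| <= 1) ->
  0 <= delta <= 1 -> (size js <= mdeg e)%N ->
  exists (P : {mpoly F[m]}) (E : 'X_{1..m}),
    [/\ (E <= e)%MM, mdeg E = size js, forall j, j \in js -> P.@[x j] = 0 &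
      forall f : 'X_{1..m}, (mdeg (f + E)%MM < D)%N ->
      `|point_functional (P * 'X_[f]) - point_functional 'X_[f + E]|
        <= (2%:R ^+ size js - 1) * delta].
Proof.
move=> xd phi1 /andP[d0 d1]; elim: js => [|j js IH] /= je.
  exists 1, 0%MM; split; rewrite ?mdeg0 //; first by apply/mnm_lepP => a; rewrite mnm0E.
  by move=> f _; rewrite mul1r addm0 subrr normr0 subrr mul0r.
have [P [E [Ee Es P0 PE]]] := IH (ltnW je).
have [a Ea] : exists a, (U_(a) <= e - E)%MM.
  have : (e - E)%MM != 0%MM.
    by rewrite -mdeg_eq0 -lt0n -(ltn_add2r (mdeg E)) -mdegD submK // Es.
  rewrite -mdeg_eq0 mdegE sum_nat_eq0 => /forallPn[a]; rewrite /= => h.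
  by exists a; rewrite lep1mP.
exists (P * ('X_a - (x j a)%:MP)), (E + U_(a))%MM; split.
- rewrite -(submK Ee) [(E + _)%MM]addmC; apply/mnm_lepP => b.
  by rewrite [leqLHS]mnmDE [leqRHS]mnmDE leq_add2r; apply/mnm_lepP.
- by rewrite mdegD mdeg1 Es addn1.
- move=> j'; rewrite inE mevalM mevalB mevalXU mevalC => /predU1P[->|/P0 ->].
    by rewrite subrr mulr0.
  by rewrite mul0r.
move=> f fD.
have -> : P * ('X_a - (x j a)%:MP) * 'X_[f] = P * 'X_[f + U_(a)] - x j a *: (P * 'X_[f]).
  rewrite mulrBr mulrBl -mul_mpolyC mpolyXD; congr (_ - _); last by rewrite -mulrA mulrCA.
  by rewrite -mulrA ['X_a * _]mulrC.
have lin Q s : point_functional (Q - s *: (P * 'X_[f])) =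
    point_functional Q - s * point_functional (P * 'X_[f]).
  rewrite point_functionalB; congr (_ - _); rewrite /point_functional big_distrr /=.
  by apply: eq_bigr => l _; rewrite mevalZ mulrCA.
rewrite lin; have -> : (f + (E + U_(a)) = f + U_(a) + E)%MM by rewrite [(E + _)%MM]addmC addmA.
have D1 : (mdeg (f + U_(a) + E)%MM < D)%N.
  by move: fD; rewrite !mdegD addnAC -addnA.
have D2 : (mdeg (f + E)%MM < D)%N.
  by apply: leq_trans D1; rewrite !mdegD ltnS addnAC leq_addr.
have h1 := PE _ D1; have h2 := PE _ D2.
rewrite addrAC; apply: le_trans (ler_normB _ _) _.
(* The new error term is [x j a], at most [delta], times a value bounded by 1 + (2^s - 1) delta <=
   2^s, where s is the size of [js]. *)
have -> : (2%:R ^+ (size js).+1 - 1) * delta =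
    (2%:R ^+ size js - 1) * delta + delta * 2%:R ^+ size js.
  by rewrite exprS; ring.
apply: lerD => //; rewrite normrM; apply: ler_pM => //.
rewrite -[point_functional (P * _)](subrK (point_functional 'X_[f + E])).
apply: le_trans (ler_normD _ _) _; rewrite -[leRHS](subrK 1).
apply: lerD; last exact: phi1.
apply: le_trans h2 _; rewrite -[leRHS]mulr1; apply: ler_wpM2l => //.
by rewrite subr_ge0 exprn_ege1 // ler1n.
Qed.
End PointFunctional.

(** * Regularity near the origin *)

Definition monomial_forms (F : numFieldType) m k N (a : 'I_N * mon m k -> nat)
    (x : 'I_m -> F) : 'rV[F]_N :=
  \row_l \sum_e (a (l, e))%:R * 'X_[mon_mnm e].@[x].

Lemma inv_succ_lt (eps : CC) : 0 < eps ->
  exists M : nat, forall n, (M <= n)%N -> n.+1%:R^-1 < eps.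
Proof.
case: eps => e e'; rewrite ltcE /= => /andP[/eqP -> e0].
exists (Num.truncn e^-1) => n Mn; rewrite -[X in _ < X]/(e%:C)%C.
have -> : n.+1%:R^-1 = (n.+1%:R^-1 : RR)%:C%C :> CC by rewrite fmorphV rmorph_nat.
rewrite ltcR -[ltRHS]invrK ltf_pV2 ?posrE ?ltr0Sn ?invr_gt0 //.
by apply: lt_le_trans (truncnS_gt _) _; rewrite ler_nat ltnS.
Qed.

Section LocalRegularity.
Variables (m k N : nat) (a : 'I_N * mon m k -> nat).
Hypothesis generic_a : forall phi : 'X_{1..m} -> CC,
  (forall e, (k <= mdeg e)%N -> phi e = 0) -> (exists e, phi e <> 0) ->
  (\rank (hankel phi k) <= k)%N ->
  exists l, \sum_e (a (l, e))%:R * phi (mon_mnm e) <> 0.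

(** Functionals are recorded by their values in degrees below 2k, which include all entries of the
    Hankel matrix of order [k]; so compactness is needed in finite dimension only. *)
Let T : finType := mon m (k * 2).
Let ext (y : T -> CC) (e : 'X_{1..m}) : CC := \sum_t (e == mon_mnm t)%:R * y t.

Let ext_mon y t : ext y (mon_mnm t) = y t.
Proof.
rewrite /ext (bigD1 t) //= eqxx mul1r big1 ?addr0 // => t' t't.
by rewrite (inj_eq (@mon_mnm_inj _ _)) eq_sym (negPf t't) mul0r.
Qed.

Let polyfun_ext_mon e : polyfun (ext^~ e).
Proof.
apply: polyfun_sum => t _; apply: pf_mul; [exact: pf_cst | exact: pf_coord].
Qed.

(** A linear relation between the images is a combination of evaluations that kills every form; it
    is nonzero on some monomial of degree below [k] and can be scaled to norm 1. *)
Lemma dependency_functional (x : 'I_k -> 'I_m -> CC) : injective x ->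
  ~~ row_free (\matrix_(j < k) monomial_forms a (x j)) ->
  exists c : 'I_k -> CC,
    \sum_(t : T) `|point_functional x c 'X_[mon_mnm t]| = 1 /\
    forall l, \sum_e (a (l, e))%:R * point_functional x c 'X_[mon_mnm e] = 0.
Proof.
move=> xi; rewrite -kermx_eq0 => /rowV0Pn[c /sub_kermxP cM /rV0Pn[j0 cj0]].
have [e ek phie] := point_functional_neq0 xi (ex_intro (fun j => c 0 j <> 0) j0 (elimN eqP cj0)).
pose S := \sum_(t : T) `|point_functional x (c 0) 'X_[mon_mnm t]|.
have [t te] : exists t : T, mon_mnm t = e.
  by apply: mon_mnm_surj; apply: leq_trans ek _; rewrite muln2 -addnn leq_addr.
have S0 : 0 < S.
  rewrite /S (bigD1 t) //= te ltr_wpDr ?sumr_ge0 // normr_gt0; exact/eqP.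
have scale P : point_functional x (fun j => S^-1 * c 0 j) P = S^-1 * point_functional x (c 0) P.
  by rewrite /point_functional big_distrr /=; apply: eq_bigr => j _; rewrite mulrA.
exists (fun j => S^-1 * c 0 j); split.
  under eq_bigr do rewrite scale normrM ger0_norm ?invr_ge0 ?ltW //.
  by rewrite -big_distrr /= -/S mulVf // gt_eqF.
move=> l; transitivity (S^-1 * (c *m \matrix_(j < k) monomial_forms a (x j)) 0 l); last first.
  by rewrite cM mxE mulr0.
rewrite mxE; under [in RHS]eq_bigr do rewrite !mxE big_distrr /=.
rewrite exchange_big big_distrr /=; apply: eq_bigr => f _.
rewrite scale mulrCA /point_functional; congr (_ * _); rewrite big_distrr /=.
by apply: eq_bigr => j _; rewrite mulrCA.
Qed.

(** Lower semicontinuity of the rank. If the limit had rank r > k, fixed [A] and [B] would make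
    det(A H B) equal to 1 at the limit, while this polynomial vanishes along the sequence. *)
Lemma rank_limit (u : nat -> T -> CC) (l : T -> CC) :
  (forall eps : CC, 0 < eps -> exists n, forall t, `|u n t - l t| < eps) ->
  (forall n, (\rank (hankel (ext (u n)) k) <= k)%N) ->
  (\rank (hankel (ext l) k) <= k)%N.
Proof.
move=> ul uk; rewrite leqNgt; apply/negP; set H := hankel (ext l) k.
set r := \rank H => kr.
pose A : 'M[CC]_(r, _) := pid_mx r *m invmx (col_ebase H).
pose B : 'M[CC]_(_, r) := invmx (row_ebase H) *m pid_mx r.
have AHB : A *m H *m B = 1%:M.
  rewrite -[in LHS](mulmx_ebase H) /A /B !mulmxA mulmxKV ?col_ebase_unit //.
  rewrite mulmxK ?row_ebase_unit // !pid_mx_id ?rank_leq_row //.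
  by rewrite pid_mx_1.
pose p y := \det (\matrix_(i < r, j < r) \sum_t (\sum_s A i s * hankel (ext y) k s t) * B t j).
have pE y : p y = \det (A *m hankel (ext y) k *m B).
  by congr (\det _); apply/matrixP => i j; rewrite !mxE; apply: eq_bigr => t _; rewrite !mxE.
have pp : polyfun p.
  apply: polyfun_det => i j; apply: polyfun_sum => t _; apply: pf_mul; last exact: pf_cst.
  apply: polyfun_sum => s _; apply: pf_mul; first exact: pf_cst.
  by apply: (polyfun_ext (polyfun_ext_mon
    (mon_mnm (enum_val s) + mon_mnm (enum_val t))%MM)) => y; rewrite mxE.
have : p l = 0.
  apply: (polyfun_cluster (u := u)) => // n; rewrite pE; apply/eqP.
  apply: contraLR kr; rewrite -unitfE -unitmxE -leqNgt => /mxrank_unit <-.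
  apply: leq_trans (uk n); apply: leq_trans (mxrankM_maxl _ _) (mxrankM_maxr _ _).
by rewrite pE AHB det1 => /eqP; rewrite oner_eq0.
Qed.

Lemma locally_regular : exists n : nat, forall x : 'I_k -> 'I_m -> CC, injective x ->
  (forall j t, `|x j t| <= n.+1%:R^-1) ->
  row_free (\matrix_(j < k) monomial_forms a (x j)).
Proof.
apply: NNPP => nreg.
have /functional_choice[x hx] (n : nat) : exists x : 'I_k -> 'I_m -> CC,
    [/\ injective x, forall j t, `|x j t| <= n.+1%:R^-1 &
        ~~ row_free (\matrix_(j < k) monomial_forms a (x j))].
  apply: NNPP => nx; apply: nreg; exists n => x xi xn; apply: contraT => nf.
  by case: nx; exists x.
have /functional_choice[c hc] n : exists c : 'I_k -> CC,
    \sum_(t : T) `|point_functional (x n) c 'X_[mon_mnm t]| = 1 /\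
    forall l, \sum_e (a (l, e))%:R * point_functional (x n) c 'X_[mon_mnm e] = 0.
  by have [xi _ nf] := hx n; apply: dependency_functional.
pose u n (t : T) := point_functional (x n) (c n) 'X_[mon_mnm t].
have u1 n t : `|u n t| <= 1.
  by rewrite -(hc n).1 (bigD1 t) //= lerDl sumr_ge0.
have [l hl] := bolzano_weierstrass_C u1.
have hl0 eps : 0 < eps -> exists n, forall t, `|u n t - l t| < eps.
  by move=> /(hl _ 0%N)[n _ h]; exists n.
have extu n e : (mdeg e < k * 2)%N -> ext (u n) e = point_functional (x n) (c n) 'X_[e].
  by move=> /mon_mnm_surj[t <-]; rewrite ext_mon.
(* Peeling off a factor for every point gives a polynomial that vanishes at all of them, so only the
   error term remains. *)
have smallu n t : (k <= mdeg (mon_mnm t))%N -> `|u n t| <= 2%:R ^+ k * n.+1%:R^-1.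
  move=> kt; have [xi xn _] := hx n.
  have [|||P [E [Et Es P0 PE]]] := @point_functional_near _ _ _ (x n) (c n) (k * 2)
      n.+1%:R^-1 (enum 'I_k) (mon_mnm t) xn.
  - by move=> f fk; rewrite -extu //; have [s <-] := mon_mnm_surj fk; rewrite ext_mon.
  - by rewrite invr_ge0 ler0n invf_le1 ?ltr0Sn // ler1n.
  - by rewrite size_enum_ord.
  have := PE (mon_mnm t - E)%MM; rewrite submK // => /(_ (mdeg_mon t)).
  have -> : point_functional (x n) (c n) (P * 'X_[(mon_mnm t - E)%MM]) = 0.
    rewrite /point_functional big1 // => j _; rewrite mevalM P0 ?mem_enum //.
    by rewrite mul0r mulr0.
  rewrite sub0r normrN size_enum_ord => h; apply: le_trans h _.
  by rewrite ler_wpM2r ?invr_ge0 ?ler0n // gerBl.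
have l0 t : (k <= mdeg (mon_mnm t))%N -> l t = 0.
  move=> kt; apply: lt_eps_eq0 => eps eps0.
  have e2 : 0 < eps / 2%:R by rewrite divr_gt0.
  have e3 : 0 < eps / 2%:R / 2%:R ^+ k by rewrite divr_gt0 ?exprn_gt0.
  have [M hM] := inv_succ_lt e3.
  have [n Mn hn] := hl _ M e2.
  rewrite -(subKr (u n t) (l t)) (splitr eps).
  apply: le_lt_trans (ler_normB _ _) _; apply: ltrD; last exact: hn.
  apply: le_lt_trans (smallu n t kt) _.
  by rewrite mulrC -ltr_pdivlMr ?exprn_gt0 // hM.
have phi_k e : (k <= mdeg e)%N -> ext l e = 0.
  move=> ke; rewrite /ext big1 // => t _; case: eqP => [E|]; last by rewrite mul0r.
  by rewrite l0 ?mulr0 // -E.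
have phi0 : exists e, ext l e <> 0.
  apply: NNPP => nex; have {nex}lz t : l t = 0.
    by apply: NNPP => h; apply: nex; exists (mon_mnm t); rewrite ext_mon.
  (* Were the limit zero, all #|T| values would be below this bound at some index, against their sum
     being 1. *)
  have e0 : 0 < #|T|.+1%:R^-1 :> CC by rewrite invr_gt0 ltr0Sn.
  have [n hn] := hl0 _ e0; have : (1 : CC) < 1.
    rewrite -{1}(hc n).1; apply: (@le_lt_trans _ _ (\sum_(t : T) #|T|.+1%:R^-1)).
      by apply: ler_sum => t _; have := hn t; rewrite lz subr0 => /ltW.
    by rewrite sumr_const -[_ *+ _]mulr_natl ltr_pdivrMr ?ltr0Sn // mul1r ltr_nat.
  by rewrite ltxx.
have phi_rank : (\rank (hankel (ext l) k) <= k)%N.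
  apply: rank_limit hl0 _ => n.
  have -> : hankel (ext (u n)) k = hankel (fun e => point_functional (x n) (c n) 'X_[e]) k.
    apply/matrixP => s t; rewrite !mxE extu // mdegD muln2 -addnn.
    by rewrite -addSn leq_add ?mdeg_mon // ltnW ?mdeg_mon.
  exact: point_hankel_rank.
have [i hi] := generic_a phi_k phi0 phi_rank; apply: hi.
have pp : polyfun (fun y => \sum_e (a (i, e))%:R * ext y (mon_mnm e)).
  by apply: polyfun_sum => e _; apply: pf_mul; [exact: pf_cst|].
apply: (polyfun_cluster pp _ hl0) => n; rewrite -[RHS]((hc n).2 i).
apply: eq_bigr => e _; rewrite extu //; apply: leq_trans (mdeg_mon e) _.
by rewrite muln2 -addnn leq_addr.
Qed.

End LocalRegularity.

(** * Regular maps *)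

(** An injection of the whole field into the disc of radius 1/(n + 1), used coordinatewise to enter
    the polydisc of regularity. *)
Definition squash (F : numFieldType) (n : nat) (z : F) : F :=
  n.+1%:R^-1 * (z / (1 + `|z|)).

Section Squash.
Variables (F : numFieldType) (n : nat).
Implicit Types z w : F.

Let den_gt0 z : 0 < 1 + `|z|.
Proof. by rewrite ltr_pwDl. Qed.

Lemma squash_le z : `|squash n z| <= n.+1%:R^-1.
Proof.
rewrite normrM ger0_norm ?invr_ge0 ?ler0n // -[leRHS]mulr1.
rewrite ler_wpM2l ?invr_ge0 ?ler0n // normf_div (gtr0_norm (den_gt0 z)).
by rewrite ler_pdivrMr // mul1r lerDr.
Qed.

(** Taking norms first gives equality of the absolute values, after which the denominators
    cancel. *)
Lemma squash_inj : injective (@squash F n).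
Proof.
move=> z w /(mulfI (invr_neq0 (lt0r_neq0 (ltr0Sn F n)))) E.
have zw : z * (1 + `|w|) = w * (1 + `|z|).
  have := congr1 (fun t => t * (1 + `|z|) * (1 + `|w|)) E => /=.
  by rewrite divfK ?gt_eqF // mulrAC divfK ?gt_eqF.
have : `|z| * (1 + `|w|) = `|w| * (1 + `|z|).
  by have := congr1 Num.norm zw; rewrite !normrM !(gtr0_norm (den_gt0 _)).
rewrite !mulrDr !mulr1 [`|w| * _]mulrC => /addIr nzw.
by move: zw; rewrite nzw => /(mulIf (lt0r_neq0 (den_gt0 w))).
Qed.

Lemma squash_lipschitz z w : `|squash n w - squash n z| <= 2%:R * `|w - z|.
Proof.
have E : squash n w - squash n z = n.+1%:R^-1 *
    (((w - z) * (1 + `|z|) + z * (`|z| - `|w|)) / ((1 + `|w|) * (1 + `|z|))).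
  rewrite /squash -mulrBr; congr (_ * _).
  by field; rewrite !gt_eqF.
rewrite {}E normrM ger0_norm ?invr_ge0 ?ler0n //.
have n1 : n.+1%:R^-1 <= 1 :> F by rewrite invf_le1 ?ltr0Sn // ler1n.
apply: le_trans (ler_wpM2r (normr_ge0 _) n1) _.
rewrite mul1r normf_div (gtr0_norm (mulr_gt0 (den_gt0 w) (den_gt0 z))).
rewrite ler_pdivrMr ?mulr_gt0 //.
apply: le_trans (ler_normD _ _) _; rewrite !normrM (gtr0_norm (den_gt0 z)).
apply: (@le_trans _ _ (2%:R * `|w - z| * (1 + `|z|))); last first.
  rewrite mulrA; apply: ler_wpM2r; first exact/ltW/den_gt0.
  by rewrite ler_peMr ?mulr_ge0 // lerDl.
have -> : 2%:R * `|w - z| * (1 + `|z|) =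
    `|w - z| * (1 + `|z|) + (1 + `|z|) * `|w - z| by ring.
rewrite lerD2l; apply: ler_pM => //; first by rewrite lerDr.
by rewrite distrC; apply: le_trans (ler_dist_dist _ _) _.
Qed.

End Squash.

Definition regular_map (F : numFieldType) m k N (a : 'I_N * mon m k -> nat) (n : nat)
    (x : 'rV[F]_m) : 'rV[F]_N := monomial_forms a (fun t => squash n (x 0 t)).

Lemma regular_map_continuous (F : numFieldType) m k N (a : 'I_N * mon m k -> nat) n :
  rv_continuous (@regular_map F m k N a n).
Proof.
move=> x eps eps0.
have pp l : polyfun (fun y : 'I_m -> F => monomial_forms a y 0 l).
  have H : polyfun (fun y : 'I_m -> F =>
      \sum_e (a (l, e))%:R * 'X_[@mon_mnm m k e].@[y]).
    apply: polyfun_sum => e _; apply: pf_mul; first exact: pf_cst.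
    exact: polyfun_meval.
  by apply: polyfun_ext H _ => y; rewrite mxE.
have /fin_all_exists2[dl dl0 hdl] (l : 'I_N) :=
  polyfun_continuous (fun t => squash n (x 0 t)) (pp l) eps0.
have [d d0 hd] : exists2 d : F, 0 < d & forall l, d <= dl l.
  suff [d d0 hd] : exists2 d : F, 0 < d & forall l, l \in enum 'I_N -> d <= dl l.
    by exists d => // l; apply: hd; rewrite mem_enum.
  elim: (enum 'I_N) => [|l s [d d0 hd]]; first by exists 1.
  have [c [c0 cd cl]] := exists_lt2 d0 (dl0 l).
  exists c => // l'; rewrite inE => /predU1P[->|/hd]; first exact: ltW.
  by apply: le_trans; apply: ltW.
exists (d / 2%:R) => [|y hy l]; first by rewrite divr_gt0.
apply: hdl => t; apply: lt_le_trans (hd l).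
apply: le_lt_trans (squash_lipschitz _ _ _) _.
by rewrite mulrC -ltr_pdivlMr.
Qed.

Lemma monomial_forms_map (R S : numFieldType) (f : {rmorphism R -> S}) m k N
    (a : 'I_N * mon m k -> nat) (x : 'I_m -> R) :
  map_mx f (monomial_forms a x) = monomial_forms a (fun t => f (x t)).
Proof.
apply/rowP => l; rewrite !mxE rmorph_sum; apply: eq_bigr => e _.
rewrite rmorphM rmorph_nat !mevalX rmorph_prod; congr (_ * _).
by apply: eq_bigr => t _; rewrite rmorphXn.
Qed.

Theorem theorem1p13 (m k : nat) (d : nat -> nat) :
  (0 < m)%N -> (2 <= k)%N ->
  (forall i : nat, (2 <= i <= k)%N -> zdim (@gor_locus_charts CC m i) (d i)) ->
  let N := (\max_(2 <= i < k.+1) (d i + i))%N in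
  (exists f : 'rV[RR]_m -> 'rV[RR]_N, kregular k f) /\
  (exists g : 'rV[CC]_m -> 'rV[CC]_N, kregular k g).
Proof.
move=> _ k2 hd N.
have hN i : (2 <= i <= k)%N -> (d i + i <= N)%N.
  move=> ik; apply: (@leq_bigmax_seq _ _ predT (fun i => d i + i)%N) => //.
  by rewrite mem_index_iota ltnS.
have N0 : (0 < N)%N by apply: leq_trans (hN 2%N _); rewrite ?k2 // addn2.
have k0 : (0 < k)%N by apply: leq_trans k2.
have [a ga] := exists_generic_forms k0 N0 hd hN.
have [n hn] := locally_regular ga.
split; exists (regular_map a n); (split; first exact: regular_map_continuous) => x xi.
(* Linear independence is tested over [CC]; the coefficients being natural numbers, the real map is
   the restriction of the complex one. *)
- rewrite -(row_free_map (real_complex RR)).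
  have -> : map_mx (real_complex RR) (\matrix_j regular_map a n (x j)) =
      \matrix_j monomial_forms a (fun t => (squash n (x j 0 t))%:C%C).
    by apply/row_matrixP => j; rewrite -map_row !rowK; exact: monomial_forms_map.
  apply: hn => [j j' E|j t].
    apply: xi; apply/rowP => t; apply: (@squash_inj _ n).
    by have := congr1 (fun v => v t) E; apply: complexI.
  rewrite normc_def /= expr0n addr0 sqrtr_sqr.
  have -> : n.+1%:R^-1 = (n.+1%:R^-1 : RR)%:C%C :> CC by rewrite fmorphV rmorph_nat.
  by rewrite lecR; apply: squash_le.
- apply: hn => [j j' E|j t]; last exact: squash_le.
  apply: xi; apply/rowP => t; apply: (@squash_inj _ n).
  by have := congr1 (fun v => v t) E.
Qed.
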